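(* Let $G$ be a connected graph and $(H, f)$ be a valued cover of $G$ with $f(v, 1) + f(v, 2) + \dots + f(v, s) \geq \deg_{G}(v)$ for each vertex $v \in V(G)$. Then $H$ has a strictly $f$-degenerate transversal if and only if $(H, f)$ is non-constructible (that is, not constructible).
   Context: All graphs are simple, finite and undirected. $s$ is a positive integer and $[s] = \{1, \dots, s\}$. Covers. A cover of a graph $G$ is a graph $H$ with vertex set $\bigcup_{v \in V(G)} X_v$, where $X_v = \{(v,1), \dots, (v,s)\}$, and edge set $\bigcup_{uv \in E(G)} \mathscr{M}_{uv}$, where each $\mathscr{M}_{uv}$ is a (possibly empty) matching between $X_u$ and $X_v$. A valued cover of $G$ is a pair $(H, f)$ with $H$ a cover of $G$ and $f$ a function from $V(H)$ to the nonnegative integers; write $f(v,q)$ for $f((v,q))$. A set $R \subseteq V(H)$ is a transversal of $H$ if $|R \cap X_v| = 1$ for each $v \in V(G)$. A graph with a nonnegative integer valued function $f$ on its vertices is strictly $f$-degenerate if every nonempty subgraph $\Gamma$ of it has a vertex $x$ with $\deg_\Gamma(x) < f(x)$. A transversal $R$ is a strictly $f$-degenerate transversal if the induced subgraph $H[R]$ is strictly $f$-degenerate. Kernel. The kernel of $H$ (for a valued cover $(H,f)$) is the subgraph obtained from $H$ by deleting each vertex $(u,j)$ with $f(u,j) = 0$. Special graphs. $\widetilde{K_p}$ is the Cartesian product of the complete graph $K_p$ and an independent $s$-set, i.e. $s$ disjoint copies of $K_p$. The circular ladder graph $\Gamma_n$ is the Cartesian product of the cycle $C_n$ and an independent set with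 two vertices, i.e. two disjoint copies of $C_n$. The Möbius ladder $M_n$ is the graph with vertex set $\{(i,j) : i \in [n], j \in [2]\}$ in which two vertices $(i,j)$ and $(i',j')$ are adjacent if and only if (up to exchanging the two) either $i' = i+1$ and $j = j'$ for $1 \leq i \leq n-1$, or $i = n$, $i' = 1$ and $j \neq j'$. Building covers. A building cover is a valued cover $(H,f)$ of a 2-connected graph $B$ ($K_2$ being allowed) such that $f(v,1) + \dots + f(v,s) = \deg_B(v)$ for each $v \in V(B)$ and at least one of the following holds: (i) the kernel of $H$ is isomorphic to $B$ (such a cover is called a monoblock); (ii) $B$ is isomorphic to a complete graph $K_p$ for some $p \geq 2$, and the kernel of $H$ is isomorphic to $\widetilde{K_p}$ with $f$ being constant on each component of $\widetilde{K_p}$; (iii) $B$ is isomorphic to an odd cycle $C_n$, and the kernel of $H$ is isomorphic to the circular ladder graph $\Gamma_n$ with $f = 1$ on the kernel; (iv) $B$ is isomorphic to an even cycle $C_n$, and the kernel of $H$ is isomorphic to the Möbius ladder $M_n$ with $f = 1$ on the kernel. Constructible covers (defined recursively). Every building cover is constructible. A valued cover $(H,f)$ of a graph $G$ is also constructible if it is obtained from a constructible valued cover $(H^{(1)}, f^{(1)})$ of $G^{(1)}$ and a constructible valued cover $(H^{(2)}, f^{(2)})$ of $G^{(2)}$ such that all of the following hold: (i) $G$ is obtained from $G^{(1)}$ and $G^{(2)}$ by identifying a vertex $w_1$ in $G^{(1)}$ and a vertex $w_2$ in $G^{(2)}$ as a new vertex $w$; (ii) $H$ is obtained from $H^{(1)}$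 and $H^{(2)}$ by identifying $(w_1,q)$ and $(w_2,q)$ as a new vertex $(w,q)$ for each $q \in [s]$; and (iii) $f(w,q) = f^{(1)}(w_1,q) + f^{(2)}(w_2,q)$ for each $q \in [s]$, $f = f^{(1)}$ on $H^{(1)} - X_w$ and $f = f^{(2)}$ on $H^{(2)} - X_w$.
   Formalization: In building covers of type (ii) the kernel may be any number of disjoint copies of K_p, not exactly s (with s the claim fails for K_4, s=3, three copies of K_4 with f=1,2,0); and the case where G is a single vertex with f identically 0, for which the claim fails, is excluded. *)

(* Defs.v *)
From mathcomp Require Import all_boot.

Set Implicit Arguments.
Unset Strict Implicit.
Unset Printing Implicit Defensive.

(* A graph is given by its vertex type T : finType and its adjacency e : rel T. *)

Definition simple_graph (T : finType) (e : rel T) : Prop :=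
  symmetric e /\ irreflexive e.

Definition connected (T : finType) (e : rel T) : Prop :=
  0 < #|T| /\ forall x y : T, connect e x y.

Definition deg (T : finType) (e : rel T) (x : T) : nat := #|[set y | e x y]|.

Definition induced (T : finType) (P : pred T) (e : rel T) : rel {x : T | P x} :=
  [rel x y | e (val x) (val y)].

Definition isomorphic (T U : finType) (e : rel T) (e' : rel U) : Prop :=
  exists2 phi : T -> U,
    bijective phi & forall x y : T, e' (phi x) (phi y) = e x y.

(* (A, g) is a subgraph of (T, e), not necessarily induced. *)
Definition is_subgraph (T : finType) (A : {set T}) (g e : rel T) : Prop :=
  simple_graph g /\ forall x y : T, g x y -> [/\ x \in A, y \in A & e x y].

Definition strictly_degenerate (T : finType) (e : rel T) (f : T -> nat) : Prop :=
  forall (A : {set T}) (g : rel T), is_subgraph A g e -> A != set0 ->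
    exists2 x : T, x \in A & deg g x < f x.

Definition two_connected (T : finType) (e : rel T) : Prop :=
  [/\ 2 < #|T|, connected e
    & forall v : T, connected (induced (P := fun x => x != v) e)].

Definition complete_graph (p : nat) : rel 'I_p := [rel x y | x != y].

Definition edgeless_graph (r : nat) : rel 'I_r := [rel x y | false].

Definition cycle_graph (n : nat) : rel 'I_n :=
  [rel x y : 'I_n | (x.+1 %% n == y) || (y.+1 %% n == x)].

Definition cartesian (T U : finType) (e : rel T) (e' : rel U) : rel (T * U) :=
  [rel x y | ((x.1 == y.1) && e' x.2 y.2) || ((x.2 == y.2) && e x.1 y.1)].

Definition complete_copies (p r : nat) : rel ('I_p * 'I_r) :=
  cartesian (@complete_graph p) (@edgeless_graph r).

Definition circular_ladder (n : nat) : rel ('I_n * 'I_2) :=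
  cartesian (@cycle_graph n) (@edgeless_graph 2).

Definition mobius_arc (n : nat) : rel ('I_n * 'I_2) :=
  [rel x y : 'I_n * 'I_2 | ((x.1.+1 == y.1 :> nat) && (x.2 == y.2))
                          || [&& x.1.+1 == n, y.1 == 0 :> nat & x.2 != y.2]].

Definition mobius_ladder (n : nat) : rel ('I_n * 'I_2) :=
  [rel x y | mobius_arc x y || mobius_arc y x].

(* The last clause makes the edges between X_u and X_v a matching: by symmetry
   of H it bounds the degrees on both sides. *)
Definition is_cover (s : nat) (T : finType) (e : rel T) (H : rel (T * 'I_s))
    : Prop :=
  [/\ simple_graph H,
      forall (u v : T) (q r : 'I_s), H (u, q) (v, r) -> e u v
    & forall (u v : T) (q r r' : 'I_s),
        H (u, q) (v, r) -> H (u, q) (v, r') -> r = r'].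

Definition transversal (s : nat) (T : finType) (R : {set T * 'I_s}) : Prop :=
  forall v : T, #|R :&: [set x | x.1 == v]| = 1.

Definition strictly_degenerate_transversal (s : nat) (T : finType)
    (H : rel (T * 'I_s)) (f : T * 'I_s -> nat) (R : {set T * 'I_s}) : Prop :=
  transversal R /\
  strictly_degenerate (induced (P := fun x => x \in R) H) (fun x => f (val x)).

Definition kernel (s : nat) (T : finType) (H : rel (T * 'I_s))
    (f : T * 'I_s -> nat) : rel {x : T * 'I_s | f x != 0} :=
  induced (P := fun x => f x != 0) H.

Arguments kernel {s T} H f.

Definition monoblock (s : nat) (T : finType) (e : rel T) (H : rel (T * 'I_s))
    (f : T * 'I_s -> nat) : Prop :=
  isomorphic (kernel H f) e.

(* The number r of copies of K_p is not tied to s: a layer on which f vanishes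
   is not in the kernel.  (With r = s, the cover of K_4 by three copies of K_4
   carrying the values 1, 2, 0 would be neither constructible nor have a
   strictly f-degenerate transversal.) *)
Definition complete_block (s : nat) (T : finType) (e : rel T)
    (H : rel (T * 'I_s)) (f : T * 'I_s -> nat) : Prop :=
  exists p r : nat,
    [/\ 2 <= p, isomorphic e (@complete_graph p),
        isomorphic (kernel H f) (@complete_copies p r)
      & forall x y, connect (kernel H f) x y -> f (val x) = f (val y)].

Definition odd_cycle_block (s : nat) (T : finType) (e : rel T)
    (H : rel (T * 'I_s)) (f : T * 'I_s -> nat) : Prop :=
  exists n : nat,
    [/\ 3 <= n, odd n, isomorphic e (@cycle_graph n),
        isomorphic (kernel H f) (@circular_ladder n)
      & forall x : T * 'I_s, f x != 0 -> f x = 1].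

Definition even_cycle_block (s : nat) (T : finType) (e : rel T)
    (H : rel (T * 'I_s)) (f : T * 'I_s -> nat) : Prop :=
  exists n : nat,
    [/\ 3 <= n, ~~ odd n, isomorphic e (@cycle_graph n),
        isomorphic (kernel H f) (@mobius_ladder n)
      & forall x : T * 'I_s, f x != 0 -> f x = 1].

Definition building_cover (s : nat) (T : finType) (e : rel T)
    (H : rel (T * 'I_s)) (f : T * 'I_s -> nat) : Prop :=
  [/\ simple_graph e,
      two_connected e \/ isomorphic e (@complete_graph 2),
      is_cover e H,
      forall v : T, \sum_(q < s) f (v, q) = deg e v
    & [\/ monoblock e H f, complete_block e H f,
          odd_cycle_block e H f | even_cycle_block e H f]].

(* Vertex set T obtained from the disjoint union of T1 and T2 by identifying w1
   with w2; i1 and i2 are the resulting maps. *)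
Definition vertex_gluing (T1 T2 T : finType) (i1 : T1 -> T) (i2 : T2 -> T)
    (w1 : T1) (w2 : T2) : Prop :=
  [/\ injective i1, injective i2,
      forall x : T, (exists a, i1 a = x) \/ (exists b, i2 b = x)
    & forall a b, i1 a = i2 b <-> a = w1 /\ b = w2].

Definition edge_gluing (T1 T2 T : finType) (i1 : T1 -> T) (i2 : T2 -> T)
    (e1 : rel T1) (e2 : rel T2) (e : rel T) : Prop :=
  forall x y : T, e x y <->
    (exists a a', [/\ i1 a = x, i1 a' = y & e1 a a']) \/
    (exists b b', [/\ i2 b = x, i2 b' = y & e2 b b']).

Definition lift_layers (s : nat) (U T : finType) (i : U -> T)
    (x : U * 'I_s) : T * 'I_s := (i x.1, x.2).

Inductive constructible (s : nat) :
    forall T : finType, rel T -> rel (T * 'I_s) -> (T * 'I_s -> nat) -> Prop :=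
| constructible_building (T : finType) (e : rel T) (H : rel (T * 'I_s))
    (f : T * 'I_s -> nat) :
    building_cover e H f -> constructible e H f
| constructible_gluing (T1 T2 T : finType)
    (e1 : rel T1) (H1 : rel (T1 * 'I_s)) (f1 : T1 * 'I_s -> nat)
    (e2 : rel T2) (H2 : rel (T2 * 'I_s)) (f2 : T2 * 'I_s -> nat)
    (e : rel T) (H : rel (T * 'I_s)) (f : T * 'I_s -> nat)
    (i1 : T1 -> T) (i2 : T2 -> T) (w1 : T1) (w2 : T2) :
    constructible e1 H1 f1 ->
    constructible e2 H2 f2 ->
    vertex_gluing i1 i2 w1 w2 ->
    edge_gluing i1 i2 e1 e2 e ->
    edge_gluing (@lift_layers s T1 T i1) (@lift_layers s T2 T i2) H1 H2 H ->
    (forall q : 'I_s, f (i1 w1, q) = f1 (w1, q) + f2 (w2, q)) ->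
    (forall (a : T1) (q : 'I_s), a != w1 -> f (i1 a, q) = f1 (a, q)) ->
    (forall (b : T2) (q : 'I_s), b != w2 -> f (i2 b, q) = f2 (b, q)) ->
    constructible e H f.

(* Main.v *)
Require Import Defs.
From mathcomp Require Import all_boot zify.

Set Implicit Arguments.
Unset Strict Implicit.
Unset Printing Implicit Defensive.

(* A constructible cover has no good transversal by counting inside a building
   cover and by gluing bad subsets at cut vertices.  Conversely, let (H, f) have
   no good transversal.  If some vertex has surplus, i.e. its f-values sum to
   more than its degree, colouring it last produces a transversal, so the sums
   equal the degrees.  At a cut vertex w, f(w, q) is the sum of the largest
   values at (w, q) that keep the two sides uncolourable, so (H, f) is glued from
   two smaller such covers.  If there is no cut vertex, choosing (v, q) first
   leaves G - v without surplus, so every kernel vertex has a kernel neighbour in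
   each adjacent fibre: the kernel covers G with r sheets.  If r = 1 this is a
   monoblock.  If r > 1, comparing two choices at v shows, by induction on an end
   block of G - v, that v is adjacent to all the non-cut vertices of that block;
   this forces G to be complete or a cycle, and these cases are settled
   directly. *)

(** * Connectivity through closed subsets *)

Section Connectivity.
Variables (T : finType) (e : rel T).
Hypothesis esym : symmetric e.
Implicit Types S E K I : {set T}.

(** The colouring arguments run over subsets [S] of one fixed vertex type, with only the budget
    function changing; subtypes appear when a constructible cover has to be assembled. Surplus is
    required in every component, because deleting a vertex may disconnect the set. With several
    sheets, the comparison at [v] works because induction makes the end block complete or a cycle,
    and there budgets are constant along matching edges. Two layers at [v] cannot both be matched to
    the same vertex, so they reduce its budget differently, while a non-neighbour of [v] keeps its
    budget: constancy cannot hold for both. Splitting alters the budget at the vertex where the end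
    block is attached, hence only non-cut vertices of the block are compared. In the other
    direction, blocks are given by abstract isomorphisms of the kernel that need not respect fibres.
    Their lack of transversals is therefore proved by counting and parity, not by following
    layers. *)

Definition closed_in S E : bool :=
  [forall x in E, forall y in S, e x y ==> (y \in E)].

(** A closed subset of [S] is a union of components, so this is connectedness without paths. The
    empty set passes, so that a single vertex satisfies [nocut], and so does an edge. *)
Definition conn S : bool :=
  [forall E : {set T},
    [&& E \subset S, E != set0 & closed_in S E] ==> (E == S)].

Definition nocut S : bool := conn S && [forall v in S, conn (S :\ v)].

Definition degin S (v : T) : nat := #|[set u in S | e v u]|.

Lemma closed_inP S E :
  reflect (forall x y, x \in E -> y \in S -> e x y -> y \in E) (closed_in S E).
Proof.
apply: (iffP forall_inP) => [h x y xE yS exy|h x xE].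
  by have /forall_inP/(_ y yS)/implyP/(_ exy) := h x xE.
by apply/forall_inP => y yS; apply/implyP; apply: h xE yS.
Qed.

Lemma connP S :
  reflect (forall E, E \subset S -> E != set0 -> closed_in S E -> E = S)
          (conn S).
Proof.
apply: (iffP forallP) => [h E h1 h2 h3|h E].
  by apply/eqP; have /implyP := h E; apply; rewrite h1 h2.
by apply/implyP => /and3P[h1 h2 h3]; apply/eqP/h.
Qed.

Lemma connPn S : ~~ conn S ->
  exists E, [/\ E \subset S, E != set0, closed_in S E & E != S].
Proof.
by rewrite negb_forall => /existsP[E]; rewrite negb_imply => /andP[/and3P[]];
  exists E.
Qed.

Lemma nocutP S : reflect (conn S /\ forall v, v \in S -> conn (S :\ v)) (nocut S).
Proof. by apply: (iffP andP) => -[h1 h2]; split => //; apply/forall_inP. Qed.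

Lemma closed_inC S E : closed_in S E -> closed_in S (S :\: E).
Proof.
move=> /closed_inP cE; apply/closed_inP => x y; rewrite !inE => /andP[xE xS] yS exy.
rewrite yS andbT; apply: contra xE => yE.
by apply: cE yE xS _; rewrite esym.
Qed.

(* A union of components of [S - c], together with [c], is connected. *)
Lemma conn_branch S c E : conn S -> c \in S -> E \subset S :\ c ->
  closed_in (S :\ c) E -> conn (c |: E).
Proof.
move=> /connP cS cinS /subsetP sE /closed_inP cE; apply/connP => F /subsetP sF F0 /closed_inP cF.
case: (boolP (c \in F)) => cinF.
  (* Here [F] contains [c], the only gate between [E] and the rest, so adding everything outside [E]
     keeps it closed in [S]; hence [E] lies in [F]. *)
  have sG : F :|: (S :\: E) \subset S.
    apply/subsetP => x; rewrite inE => /orP[/sF|]; last by rewrite inE => /andP[].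
    by rewrite !inE => /orP[/eqP->|/sE] //; rewrite inE => /andP[].
  have G0 : F :|: (S :\: E) != set0 by apply/set0Pn; exists c; rewrite inE cinF.
  have cG : closed_in S (F :|: (S :\: E)).
    apply/closed_inP => x y xG yS exy; rewrite !inE yS andbT.
    case: (boolP (y \in E)) => yE; rewrite ?orbT // orbF.
    have xF : x \in F -> y \in F by move=> xF; apply: cF xF _ exy; rewrite inE yE orbT.
    move: xG; rewrite !inE => /orP[//|/andP[xE xS]].
    case: (eqVneq x c) => [xc|xc]; first by apply: xF; rewrite xc.
    case/negP: xE; apply: cE yE _ _; rewrite ?inE ?xc // esym //.
  have GS := cS _ sG G0 cG.
  apply/eqP; rewrite eqEsubset; apply/andP; split; apply/subsetP => // x.
  rewrite !inE => /orP[/eqP->//|xE].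
  have : x \in S by have := sE _ xE; rewrite inE => /andP[].
  by rewrite -GS !inE xE orbF.
have sFE x : x \in F -> x \in E.
  by move=> xF; have := sF _ xF; rewrite !inE => /orP[/eqP xc|//]; rewrite -xc xF in cinF.
have FS : F = S.
  apply: cS => //; first by apply/subsetP => x /sFE/sE; rewrite inE => /andP[].
  apply/closed_inP => x y xF yS exy; apply: (cF x) => //; rewrite !inE.
  by case: (eqVneq y c) => //= yc; apply: (cE x) => //; rewrite ?inE ?yc //; apply: sFE.
by rewrite FS cinS in cinF.
Qed.

Lemma degin_sub S S' v : S \subset S' -> degin S v <= degin S' v.
Proof.
move=> /subsetP sS; apply: subset_leq_card; apply/subsetP => x.
by rewrite !inE => /andP[/sS -> ->].
Qed.

Lemma degin_D1 S u v : u \in S -> degin S v = e v u + degin (S :\ u) v.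
Proof.
move=> uS; rewrite /degin (cardsD1 u) inE uS /=; congr (_ + _).
by apply: eq_card => x; rewrite !inE andbA.
Qed.

(** In a connected [S] this is a leaf of the block tree: [d |: I] is an end block attached at [d]
    (or all of [S]), and its interior [I] meets the rest of [S] only through [d]. *)
Definition leaf S I d : Prop :=
  [/\ I \subset S, I != set0, d \in S :\: I, closed_in (S :\ d) I & nocut (d |: I)].

Lemma leaf_nbr S I d x y : leaf S I d -> x \in I -> y \in S -> e x y -> (y == d) || (y \in I).
Proof.
case=> _ _ _ /closed_inP cI _ xI yS exy; case: eqVneq => //= yd.
by apply: (cI x); rewrite ?inE ?yd.
Qed.

(** Descent: a cut vertex [v] of [b |: K] cuts off a part avoiding [b], which is a smaller [K]
    hanging at [v]. The clause on [d] keeps leaves found on opposite sides of [b] from attaching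
    inside each other. *)
Lemma leaf_exists S K b : conn S -> b \in S -> K \subset S :\ b -> K != set0 ->
  closed_in (S :\ b) K ->
  exists I d, [/\ leaf S I d, I \subset K & d \in b |: K].
Proof.
move=> cS; move: {2}#|K| (leqnn #|K|) => n; elim: n K b => [|n IH] K b.
  by rewrite leqn0 cards_eq0 => /eqP->; rewrite eqxx.
move=> cK bS sK K0 clK; have bK : b \notin K by apply/negP => /(subsetP sK); rewrite !inE eqxx.
have sKS : K \subset S by apply: subset_trans sK (subD1set _ _).
case: (boolP (nocut (b |: K))) => ncK.
  by exists K, b; split; rewrite ?inE ?eqxx //; split; rewrite ?inE ?bK.
have cbK : conn (b |: K) by apply: conn_branch clK.
move: ncK; rewrite /nocut cbK negb_forall => /existsP[v]; rewrite negb_imply => /andP[vbK].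
have clb x y : x \in K -> y \in S -> e x y -> (y == b) || (y \in K).
  move=> xK yS exy; case: eqVneq => //= yb.
  by apply: (closed_inP _ _ clK x); rewrite ?inE ?yb.
case/connPn => E0 [sE0 E00 clE0 neE0].
(* If the part found contains [b], its complement serves instead: a part without [b] has all its
   neighbours in [b |: K], so it stays closed in the whole of [S :\ v]. *)
have [E [sE E1 clE neE bE]] : exists E, [/\ E \subset (b |: K) :\ v, E != set0,
    closed_in ((b |: K) :\ v) E, E != (b |: K) :\ v & b \notin E].
  case: (boolP (b \in E0)) => bE0; last by exists E0.
  exists ((b |: K) :\ v :\: E0); split.
  - exact: subsetDl.
  - apply: contra neE0; rewrite setD_eq0 => h; rewrite eqEsubset sE0 h //.
  - exact: closed_inC.
  - apply: contraNneq E00 => h; apply/eqP/setP => x; rewrite inE; apply/negP => xE.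
    have := subsetP sE0 x xE; rewrite -h inE xE //.
  - by rewrite inE bE0.
have sEK : E \subset K.
  apply/subsetP => x xE; have := subsetP sE x xE; rewrite !inE => /andP[_ /orP[/eqP xb|//] ].
  by rewrite xb (negbTE bE) in xE.
have vE : v \notin E by apply/negP => /(subsetP sE); rewrite !inE eqxx.
have vS : v \in S by move: vbK; rewrite inE => /orP[/set1P->//|/(subsetP sKS)].
have ltE : #|E| <= n.
  rewrite -ltnS; apply: leq_trans cK; apply: proper_card; rewrite properEneq sEK andbT.
  apply: contraNneq neE => EK; rewrite {2}EK in vE *; apply/eqP/setP => x; rewrite !inE.
  move: vbK vE; rewrite !inE EK; case: (eqVneq v b) => [->|vb] /=; last by move=> ->.
  by move=> _ _; case: (eqVneq x b) => [->|//]; rewrite (negbTE bK).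
have [||I [d [lI sI dI]]] := IH E v ltE vS _ E1.
- by rewrite subsetD1 vE andbT (subset_trans sEK).
- apply/closed_inP => x y xE; rewrite !inE => /andP[yv yS] exy.
  apply: (closed_inP _ _ clE x) => //; rewrite !inE yv /=; apply: (clb x) => //.
  exact: subsetP xE.
exists I, d; split=> //; first exact: subset_trans sEK.
move: dI; rewrite inE => /orP[/set1P->//|/(subsetP sEK)]; by rewrite !inE orbC => ->.
Qed.

Lemma two_leaves S : conn S -> ~~ nocut S -> exists I1 d1 I2 d2,
  [/\ leaf S I1 d1, leaf S I2 d2, d1 \notin I2, d2 \notin I1 &
      forall x y, x \in I1 -> y \in I2 -> (x != y) && ~~ e x y].
Proof.
move=> cS; rewrite /nocut cS negb_forall => /existsP[b]; rewrite negb_imply => /andP[bS].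
case/connPn => E [sE E0 clE neE]; pose F := S :\ b :\: E.
have F0 : F != set0.
  by apply: contra neE; rewrite setD_eq0 => h; rewrite eqEsubset sE h.
have clF : closed_in (S :\ b) F by apply: closed_inC.
have [I1 [d1 [l1 s1 h1]]] := leaf_exists cS bS sE E0 clE.
have [I2 [d2 [l2 s2 h2]]] := leaf_exists cS bS (subsetDl _ _) F0 clF.
have bE : b \notin E by apply/negP => /(subsetP sE); rewrite !inE eqxx.
exists I1, d1, I2, d2; split=> //.
- apply/negP => /(subsetP s2); move: h1; rewrite !inE => /orP[/eqP->|->] //.
  by rewrite eqxx andbF.
- apply/negP => /(subsetP s1); move: h2; rewrite !inE => /orP[/eqP->|/andP[/negP]] //.
  exact/negP.
- move=> x y /(subsetP s1) xE /(subsetP s2); rewrite inE => /andP[yE yS].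
  apply/andP; split; first by apply: contraNneq yE => <-.
  by apply: contra yE => exy; apply: (closed_inP _ _ clE x).
Qed.

Hypothesis eirr : irreflexive e.

Definition complete_on S : bool :=
  [forall u in S, forall v in S, (u != v) ==> e u v].

Lemma complete_onP S :
  reflect (forall u v, u \in S -> v \in S -> u != v -> e u v) (complete_on S).
Proof.
apply: (iffP forall_inP) => [h u v uS vS|h u uS].
  by have /forall_inP/(_ v vS)/implyP := h u uS.
by apply/forall_inP => v vS; apply/implyP; apply: h.
Qed.

Lemma complete_nocut S : complete_on S -> nocut S.
Proof.
have cc (A : {set T}) : A \subset S -> complete_on S -> conn A.
  move=> /subsetP sA /complete_onP cS; apply/connP => E sE /set0Pn[x xE] /closed_inP cE.
  have xA := subsetP sE x xE.
  apply/eqP; rewrite eqEsubset sE; apply/subsetP => y yA.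
  case: (eqVneq x y) => [<-//|xy]; apply: (cE x) => //; apply: cS => //; exact: sA.
by move=> cS; apply/nocutP; split=> [|v vS]; apply: cc; rewrite ?subD1set.
Qed.

Lemma complete_onS S S' : S' \subset S -> complete_on S -> complete_on S'.
Proof.
move=> /subsetP sS /complete_onP h; apply/complete_onP => u v /sS uS /sS vS.
exact: h.
Qed.

Definition universal S v : bool := [forall u in S, (u != v) ==> e v u].

Lemma universalPn S v : reflect (exists u, [/\ u \in S, u != v & ~~ e v u]) (~~ universal S v).
Proof.
rewrite negb_forall; apply: (iffP existsP) => -[u].
  by rewrite !negb_imply => /and3P[]; exists u.
by case=> h1 h2 h3; exists u; rewrite !negb_imply h1 h2.
Qed.

(** * Graphs in which each vertex sees every end block left by its deletion *)

Section LeavesAreNeighbours.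
Variable S : {set T}.
Hypothesis ncS : nocut S.
Hypothesis ncN : forall v x, v \in S -> nocut (S :\ v) -> x \in S :\ v -> e v x.
Hypothesis leafN : forall v I d x, v \in S -> leaf (S :\ v) I d -> x \in I -> e v x.

Lemma non_universal_leaves v : v \in S -> ~~ universal S v -> exists I1 d1 I2 d2,
  [/\ leaf (S :\ v) I1 d1, leaf (S :\ v) I2 d2, d1 \notin I2, d2 \notin I1 &
      forall x y, x \in I1 -> y \in I2 -> (x != y) && ~~ e x y].
Proof.
move=> vS /universalPn[u [uS uv neuv]]; have [_ /(_ v vS) cSv] := nocutP _ ncS.
apply: two_leaves => //; apply: contra neuv => ncSv.
by apply: (ncN vS ncSv); rewrite !inE uv.
Qed.

(** If [I1] had a second vertex, then [w], which misses the vertices of [I2], would have two leaves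
    of its own in [S :\ w]. Both must avoid [v], and then both must contain [d1], although they are
    disjoint. *)
Lemma leaf_single v I1 d1 I2 d2 w : v \in S ->
  leaf (S :\ v) I1 d1 -> leaf (S :\ v) I2 d2 -> d1 \notin I2 ->
  (forall x y, x \in I1 -> y \in I2 -> (x != y) && ~~ e x y) ->
  w \in I1 -> I1 = [set w].
Proof.
move=> vS l1 l2 d1I2 far wI1; apply/eqP; rewrite eqEsubset sub1set wI1 andbT -setD_eq0.
apply: contraT => I1w.
have [sI1 _ dI1 _ ncB] := l1; have [sI2 /set0Pn[z zI2] _ _ _] := l2.
have wS : w \in S by have := subsetP sI1 w wI1; rewrite !inE => /andP[].
have wv : w != v by have := subsetP sI1 w wI1; rewrite !inE => /andP[].
have vI1 : v \notin I1 by apply/negP => /(subsetP sI1); rewrite !inE eqxx.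
have nuw : ~~ universal S w.
  have /andP[wz ewz] := far w z wI1 zI2; apply/universalPn; exists z; split=> //.
    by have := subsetP sI2 z zI2; rewrite !inE => /andP[].
  by rewrite eq_sym.
move: dI1; rewrite !inE => /and3P[d1I1 d1v d1S].
have wd1 : d1 != w by apply: contraNneq d1I1 => ->.
have cBw : conn ((d1 |: I1) :\ w).
  by have [_] := nocutP _ ncB; apply; rewrite !inE wI1 orbT.
have near x : x \in S -> x != v -> e w x -> (x == d1) || (x \in I1).
  by move=> xS xv ewx; apply: (leaf_nbr l1 wI1) => //; rewrite !inE xv.
(* If [v] were in [J1], a vertex of [J2] would be a neighbour of [w] not adjacent to [v], which
   leaves only [d1]. Then every edge from [d1], except possibly one to [w], ends at [c2], a vertex
   of [I1]; so [d1 |: I1] is closed in [S :\ v] and no room remains for [I2]. *)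
have subA J1 c1 J2 c2 : leaf (S :\ w) J1 c1 -> leaf (S :\ w) J2 c2 ->
    (forall x y, x \in J1 -> y \in J2 -> (x != y) && ~~ e x y) -> v \notin J1.
  move=> m1 m2 far'; apply/negP => vJ1.
  have J2d x : x \in J2 -> x = d1.
    move=> xJ2; have /andP[vx nevx] := far' v x vJ1 xJ2.
    have [sJ2 _ _ _ _] := m2; have := subsetP sJ2 x xJ2; rewrite !inE => /andP[xw xS].
    have := near x xS _ (leafN wS m2 xJ2); rewrite eq_sym => /(_ vx)/orP[/eqP//|xI1].
    by rewrite (leafN vS l1 xI1) in nevx.
  have d1J2 : d1 \in J2 by have [_ /set0Pn[x xJ2] _ _ _] := m2; rewrite -(J2d x xJ2).
  have [a aI1 [aw ed1a]] : exists2 a, a \in I1 & a != w /\ e d1 a.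
    have : ~~ closed_in ((d1 |: I1) :\ w) [set d1].
      apply/negP => cl.
      have h : [set d1] = (d1 |: I1) :\ w.
        apply: (connP _ cBw) => //; first by rewrite sub1set !inE wd1 eqxx.
        by apply/set0Pn; exists d1; rewrite inE.
      case/set0Pn: I1w => a; rewrite !inE => /andP[aw aI1].
      have : a \in [set d1] by rewrite h !inE aw aI1 orbT.
      by rewrite inE => /eqP ad; rewrite -ad aI1 in d1I1.
    rewrite negb_forall => /existsP[x]; rewrite negb_imply => /andP[/set1P->].
    rewrite negb_forall => /existsP[a]; rewrite !negb_imply !inE.
    by case/and3P => /andP[aw /orP[->//|aI1]] ea _; exists a.
  have S1 x : x \in I1 -> x \in S :\ v by apply: subsetP.
  have ac2 : a = c2.
    have aS : a \in S by have := S1 a aI1; rewrite !inE => /andP[].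
    have := leaf_nbr m2 d1J2 (y := a); rewrite !inE aw aS => /(_ isT ed1a)/orP[/eqP//|/J2d ad].
    by rewrite -ad aI1 in d1I1.
  have BS : d1 |: I1 = S :\ v.
    have [_ /(_ v vS)/connP] := nocutP _ ncS; apply.
    - by apply/subsetP => x; rewrite in_setU1 => /orP[/eqP->|/S1//]; rewrite !inE d1v.
    - by apply/set0Pn; exists d1; rewrite !inE eqxx.
    apply/closed_inP => x y; rewrite in_setU1 => /orP[/eqP->|xI1] yS exy; last first.
      by rewrite !inE; apply: (leaf_nbr l1 xI1).
    rewrite !inE; case: (eqVneq y w) => [->|yw]; first by rewrite wI1 orbT.
    have yS' : y \in S :\ w by move: yS; rewrite !inE yw => /andP[].
    case/orP: (leaf_nbr m2 d1J2 yS' exy) => [/eqP->|/J2d->]; last by rewrite eqxx.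
    by rewrite -ac2 aI1 orbT.
  have := subsetP sI2 z zI2; rewrite -BS !inE => /orP[/eqP zd|zI1].
    by rewrite -zd zI2 in d1I2.
  by have := far z z zI1 zI2; rewrite eqxx.
(* Otherwise [J1] consists of neighbours of [w] inside [I1], all adjacent to [v], so [J1] is
   attached at [v]. Closedness then makes it the whole connected set [(d1 |: I1) :\ w], which
   contains [d1]. *)
have subB J1 c1 : leaf (S :\ w) J1 c1 -> v \notin J1 -> d1 \in J1.
  move=> m1 vJ1; apply: contraT => d1J1.
  have [sJ1 /set0Pn[x xJ1] _ _ _] := m1.
  have J1I y : y \in J1 -> y \in I1.
    move=> yJ1; have := subsetP sJ1 y yJ1; rewrite !inE => /andP[yw yS].
    have yv : y != v by apply: contraNneq vJ1 => <-.
    have := near y yS yv (leafN wS m1 yJ1).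
    by case/orP => // /eqP yd; rewrite -yd yJ1 in d1J1.
  have vc1 : v = c1.
    have vSw : v \in S :\ w by rewrite !inE eq_sym wv.
    have := leaf_nbr m1 xJ1 vSw; rewrite esym (leafN vS l1 (J1I x xJ1)) => /(_ isT).
    by rewrite (negbTE vJ1) orbF => /eqP.
  have JB : J1 = (d1 |: I1) :\ w.
    apply: (connP _ cBw).
    - apply/subsetP => y yJ1; rewrite !inE (J1I _ yJ1) orbT andbT.
      by have := subsetP sJ1 y yJ1; rewrite !inE => /andP[].
    - by apply/set0Pn; exists x.
    apply/closed_inP => y t yJ1; rewrite !inE => /andP[tw tB] eyt.
    have /andP[tv tS] : (t != v) && (t \in S).
      by case/orP: tB => [/eqP->|/(subsetP sI1)]; rewrite ?d1v // !inE.
    have := leaf_nbr m1 yJ1 (y := t); rewrite !inE tw tS => /(_ isT eyt).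
    by rewrite -vc1 (negbTE tv).
  by rewrite JB !inE wd1 eqxx in d1J1.
have [J1 [c1 [J2 [c2 [m1 m2 c1J2 c2J1 far']]]]] := non_universal_leaves wS nuw.
have vJ1 := subA _ _ _ _ m1 m2 far'.
have vJ2 : v \notin J2.
  by apply: (subA _ _ _ _ m2 m1) => x y xJ yJ; rewrite eq_sym esym far'.
have := far' d1 d1 (subB _ _ m1 vJ1) (subB _ _ m2 vJ2); by rewrite eqxx.
Qed.

Lemma degin_leaf1 v w d : v \in S -> leaf (S :\ v) [set w] d -> degin S w <= 2.
Proof.
move=> vS l; apply: leq_trans (_ : #|[set v; d]| <= 2); last by rewrite cards2; case: (_ != _).
apply: subset_leq_card; apply/subsetP => x; rewrite !inE => /andP[xS ewx].
case: eqVneq => //= xv; have := leaf_nbr l (x := w) (y := x); rewrite !inE eqxx xv xS => /(_ isT isT ewx).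
by case/orP => // /eqP xw; rewrite xw eirr in ewx.
Qed.

(** Deleting a vertex that is not universal leaves single-vertex leaves, whose only possible
    neighbours are that vertex and the attaching point. Being non-universal of degree at most 2 then
    spreads along edges. *)
Lemma complete_or_2regular : complete_on S \/ forall v, v \in S -> degin S v = 2.
Proof.
case: (boolP (complete_on S)) => [|nc]; [by left | right].
have [v vS nuv] : exists2 v, v \in S & ~~ universal S v.
  move: nc; rewrite negb_forall => /existsP[v]; rewrite negb_imply => /andP[vS].
  rewrite negb_forall => /existsP[u]; rewrite !negb_imply => /and3P[uS vu neuv].
  by exists v => //; apply/universalPn; exists u; rewrite eq_sym.
(* The two leaves [a] and [b] of [S :\ w] already exhaust the neighbours of [w]; as they are not
   adjacent to each other, neither is universal. *)
have step w : w \in S -> ~~ universal S w -> degin S w <= 2 ->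
    degin S w = 2 /\ forall a, a \in S -> e w a -> ~~ universal S a && (degin S a <= 2).
  move=> wS nuw dw; have [J1 [c1 [J2 [c2 [m1 m2 c1J2 c2J1 far]]]]] := non_universal_leaves wS nuw.
  have [sJ1 /set0Pn[a aJ1] _ _ _] := m1; have [sJ2 /set0Pn[b bJ2] _ _ _] := m2.
  have Ja := leaf_single wS m1 m2 c1J2 far aJ1.
  have far' x y : x \in J2 -> y \in J1 -> (x != y) && ~~ e x y.
    by move=> xJ yJ; rewrite eq_sym esym far.
  have Jb := leaf_single wS m2 m1 c2J1 far' bJ2.
  have /andP[ab neab] := far a b aJ1 bJ2.
  have aS : a \in S by have := subsetP sJ1 a aJ1; rewrite !inE => /andP[].
  have bS : b \in S by have := subsetP sJ2 b bJ2; rewrite !inE => /andP[].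
  have sub : [set a; b] \subset [set u in S | e w u].
    apply/subsetP => x; rewrite !inE => /orP[/eqP->|/eqP->].
      by rewrite aS (leafN wS m1 aJ1).
    by rewrite bS (leafN wS m2 bJ2).
  have dw2 : degin S w = 2.
    apply/eqP; rewrite eqn_leq dw /=.
    by have := subset_leq_card sub; rewrite cards2 ab.
  split=> // x xS ewx.
  have : x \in [set a; b].
    have /eqP-> : [set a; b] == [set u in S | e w u].
      by rewrite eqEcard sub cards2 ab /= -dw2.
    by rewrite inE xS.
  rewrite !inE => /orP[/eqP->|/eqP->]; apply/andP; split.
  - by apply/universalPn; exists b; rewrite eq_sym.
  - by rewrite Ja in m1; apply: degin_leaf1 m1.
  - by apply/universalPn; exists a; rewrite esym.
  - by rewrite Jb in m2; apply: degin_leaf1 m2.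
have [I1 [d1 [I2 [d2 [l1 l2 d1I2 d2I1 far]]]]] := non_universal_leaves vS nuv.
have [sI1 /set0Pn[w wI1] _ _ _] := l1; have [sI2 /set0Pn[z zI2] _ _ _] := l2.
have wS : w \in S by have := subsetP sI1 w wI1; rewrite !inE => /andP[].
have zS : z \in S by have := subsetP sI2 z zI2; rewrite !inE => /andP[].
have Iw := leaf_single vS l1 l2 d1I2 far wI1.
pose E := [set w in S | ~~ universal S w && (degin S w <= 2)].
have ES : E = S.
  have [/connP cS _] := nocutP _ ncS; apply: cS.
  - by apply/subsetP => x; rewrite inE => /andP[].
  - apply/set0Pn; exists w; rewrite inE wS /=; apply/andP; split.
      have /andP[wz newz] := far w z wI1 zI2.
      by apply/universalPn; exists z; rewrite eq_sym.
    by rewrite Iw in l1; apply: degin_leaf1 l1.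
  apply/closed_inP => x y; rewrite !inE => /and3P[xS nux dx] yS exy; rewrite yS /=.
  by have [_] := step x xS nux dx; apply.
move=> x; rewrite -ES inE => /and3P[xS nux dx].
by rewrite ES; have [] := step x xS nux dx.
Qed.

End LeavesAreNeighbours.

End Connectivity.

(** * Critical valued covers *)

Section Colouring.
Variables (s : nat) (T : finType) (e : rel T) (H : rel (T * 'I_s)).
Hypothesis esym : symmetric e.
Hypothesis eirr : irreflexive e.
Hypothesis Hsym : symmetric H.
Hypothesis HE : forall (u v : T) (q r : 'I_s), H (u, q) (v, r) -> e u v.
Hypothesis Hmatch : forall (u v : T) (q r r' : 'I_s),
  H (u, q) (v, r) -> H (u, q) (v, r') -> r = r'.
Implicit Types (S A E : {set T}) (f g : T * 'I_s -> nat).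

Lemma Hloop u q r : H (u, q) (u, r) = false.
Proof. by apply/negP => /HE; rewrite eirr. Qed.

Definition hdeg (phi : T -> 'I_s) A (v : T) : nat :=
  #|[set u in A | H (v, phi v) (u, phi u)]|.

Definition good S f (phi : T -> 'I_s) : bool :=
  [forall A : {set T}, (A \subset S) && (A != set0) ==>
    [exists v in A, hdeg phi A v < f (v, phi v)]].

Definition colorable S f : bool :=
  [exists phi : {ffun T -> 'I_s}, good S f phi].

Definition fsum f (v : T) : nat := \sum_(q < s) f (v, q).

Definition feasible S f : Prop := forall v, v \in S -> degin e S v <= fsum f v.

Lemma goodP S f phi :
  reflect (forall A, A \subset S -> A != set0 ->
             exists2 v, v \in A & hdeg phi A v < f (v, phi v))
          (good S f phi).
Proof.
apply: (iffP forallP) => [h A h1 h2|h A].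
  by have := h A; rewrite h1 h2 => /exists_inP.
by apply/implyP => /andP[h1 h2]; apply/exists_inP/h.
Qed.

Lemma eq_hdeg A v phi psi : v \in A -> {in A, phi =1 psi} ->
  hdeg phi A v = hdeg psi A v.
Proof.
move=> vA h; apply: eq_card => x; rewrite !inE.
by case: (boolP (x \in A)) => //= xA; rewrite (h _ xA) (h _ vA).
Qed.

Lemma good_weaken S S' f g phi psi : S' \subset S -> {in S', phi =1 psi} ->
  (forall v, v \in S' -> f (v, phi v) <= g (v, phi v)) ->
  good S f phi -> good S' g psi.
Proof.
move=> sS hphi hfg /goodP gd; apply/goodP => A sA A0.
have [v vA lt] := gd A (subset_trans sA sS) A0; exists v => //.
have vS := subsetP sA v vA.
rewrite -(@eq_hdeg A v phi psi vA) -?hphi //; last by move=> x xA; apply: hphi; exact: subsetP xA.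
exact: leq_trans lt (hfg _ vS).
Qed.

Lemma colorableI S f phi : good S f phi -> colorable S f.
Proof.
move=> gd; apply/existsP; exists (finfun phi).
by apply: good_weaken gd => // v _; rewrite ffunE.
Qed.

Lemma hdegD1 phi A v u : u \in A ->
  hdeg phi A v = H (v, phi v) (u, phi u) + hdeg phi (A :\ u) v.
Proof.
move=> uA; rewrite /hdeg (cardsD1 u) inE uA /=; congr (_ + _).
by apply: eq_card => x; rewrite !inE andbA.
Qed.

Lemma hdeg_sub phi A A' v : A \subset A' -> hdeg phi A v <= hdeg phi A' v.
Proof.
move=> /subsetP sS; apply: subset_leq_card; apply/subsetP => x.
by rewrite !inE => /andP[/sS -> ->].
Qed.

Lemma good_extend S f phi v : v \in S -> good (S :\ v) f phi ->
  hdeg phi S v < f (v, phi v) -> good S f phi.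
Proof.
move=> vS /goodP gd lt; apply/goodP => A sA A0.
case: (boolP (v \in A)) => vA.
  by exists v => //; apply: leq_ltn_trans lt; apply: hdeg_sub.
apply: gd => //; rewrite subsetD1 sA //.
Qed.

Lemma colorable0 f : 0 < s -> colorable set0 f.
Proof.
move=> s0; apply: (@colorableI _ _ (fun=> Ordinal s0)); apply/goodP => A.
by rewrite subset0 => ->.
Qed.

(* [reduce f v c] is the budget left on the other fibres once [(v, c)] has been
   chosen to be the last vertex removed. *)
Definition reduce f v c : T * 'I_s -> nat := fun x => f x - H (v, c) x.

(** With [v] removed last, another vertex may see one neighbour more than in [S :\ v], namely
    [(v, c)]; [reduce] has set aside exactly this unit. *)
Lemma good_reduce S f v c phi : v \in S -> 0 < f (v, c) ->
  good (S :\ v) (reduce f v c) phi ->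
  good S f (fun u => if u == v then c else phi u).
Proof.
set psi := fun u => _; move=> vS fc /(good_weaken (psi := psi)) gd.
have {}gd : good (S :\ v) (reduce f v c) psi.
  by apply: gd => // u; rewrite !inE /psi => /andP[/negbTE->].
apply/goodP => A sA A0; have psiv : psi v = c by rewrite /psi eqxx.
case: (boolP (v \in A)) => vA; last first.
  have [|u uA lt] := goodP _ _ _ gd A _ A0; first by rewrite subsetD1 sA.
  by exists u => //; apply: leq_trans lt _; apply: leq_subr.
case: (eqVneq (A :\ v) set0) => A1.
  exists v => //; rewrite psiv (_ : hdeg _ _ _ = 0) //.
  apply: eq_card0 => x; rewrite !inE; apply/negP => /andP[xA].
  have : x \notin A :\ v by rewrite A1 inE.
  by rewrite !inE xA andbT negbK => /eqP->; rewrite Hloop.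
have [|u] := goodP _ _ _ gd (A :\ v) _ A1; first by rewrite setSD.
rewrite !inE => /andP[uv uA]; rewrite /reduce ltn_subRL => lt; exists u => //.
by rewrite (hdegD1 _ _ vA) psiv Hsym.
Qed.

Lemma colorable_reduce S f v c : v \in S -> 0 < f (v, c) ->
  colorable (S :\ v) (reduce f v c) -> colorable S f.
Proof.
move=> vS fc /existsP[phi gd].
exact: colorableI (good_reduce vS fc gd).
Qed.

(** The matching meets the fibre of [u] at most once, and truncated subtraction makes the loss 0
    when the partner lies outside the kernel. Tightness after a reduction therefore detects kernel
    neighbours. *)
Lemma fsum_reduce f v c u : e v u -> 
  fsum (reduce f v c) u
  = fsum f u - [exists q, H (v, c) (u, q) && (0 < f (u, q))].
Proof.
move=> evu; rewrite /fsum /reduce.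
case: existsP => [[q /andP[hq fq]]|nex]; last first.
  rewrite subn0; apply: eq_bigr => q _; case: (boolP (H _ _)) => hq; rewrite ?subn0 //.
  by case: (posnP (f (u, q))) => [->//|fq]; case: nex; exists q; rewrite hq.
rewrite (bigD1 q) //= [in RHS](bigD1 q) //= hq.
rewrite (eq_bigr (fun r => f (u, r))); first by rewrite addnBAC.
move=> r rq; case: (boolP (H _ _)) => hr; rewrite ?subn0 //.
by rewrite (Hmatch hq hr) eqxx in rq.
Qed.

Lemma fsum_reduce_out f v c u : ~~ e v u -> fsum (reduce f v c) u = fsum f u.
Proof.
move=> evu; apply: eq_bigr => q _; rewrite /reduce.
by case: (boolP (H _ _)) => [/HE|]; rewrite ?(negbTE evu) ?subn0.
Qed.

Lemma feasible_reduce S f v c : v \in S -> feasible S f ->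
  feasible (S :\ v) (reduce f v c).
Proof.
move=> vS fe u; rewrite !inE => /andP[uv uS].
have := fe u uS; rewrite (degin_D1 _ _ vS) esym.
case: (boolP (e v u)) => evu; last by rewrite fsum_reduce_out.
by rewrite fsum_reduce //; case: [exists _, _] => /=; lia.
Qed.

Definition surplus S f : Prop := forall E : {set T}, E \subset S -> E != set0 ->
  closed_in e S E -> exists2 v, v \in E & degin e S v < fsum f v.

(** The surplus vertex [v] is coloured after the others and removed before them. A closed part of
    [S :\ v] that is not closed in [S] contains a neighbour of [v], whose degree has dropped by one,
    so surplus is inherited. *)
Lemma surplus_colorable S f : 0 < s -> feasible S f -> surplus S f -> colorable S f.
Proof.
move=> s0; move: {2}#|S| (leqnn #|S|) => n; elim: n S => [|n IH] S.
  by rewrite leqn0 cards_eq0 => /eqP-> _ _; exact: colorable0.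
move=> cS fe su; case: (eqVneq S set0) => [->|S0]; first exact: colorable0.
have [|v vS lt] := su S (subxx _) S0; first by apply/closed_inP.
have dle u : degin e (S :\ v) u <= degin e S u by apply/degin_sub/subD1set.
have /existsP[phi gd] : colorable (S :\ v) f.
  apply: IH; first by move: cS; rewrite (cardsD1 v) vS.
    by move=> u; rewrite !inE => /andP[_ /fe]; apply: leq_trans.
  move=> E sE E0 cE; case: (boolP (closed_in e S E)) => cE'.
    have [|u uE lt'] := su E _ E0 cE'; first exact: subset_trans sE (subD1set _ _).
    by exists u => //; apply: leq_ltn_trans lt'.
  have [u uE euv] : exists2 u, u \in E & e u v.
    apply/exists_inP; apply: contraNT cE' => nex.
    apply/closed_inP => x y xE yS exy; apply: (closed_inP _ _ _ cE x) => //.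
    rewrite !inE yS andbT; apply: contraNneq nex => yv; apply/exists_inP.
    by exists x => //; rewrite -yv.
  have uS : u \in S by have := subsetP sE u uE; rewrite inE => /andP[].
  by exists u => //; have := fe u uS; rewrite (degin_D1 _ _ vS) euv.
(* Pigeonhole: by the matching property each neighbour of [v] is counted for at most one layer [q],
   so the counts add up to at most [degin e S v], which is below the sum of the budgets. *)
have [q lq] : exists q, #|[set u in S | H (v, q) (u, phi u)]| < f (v, q).
  apply/existsP; apply: contraLR lt => /existsPn nex; rewrite -leqNgt.
  apply: (@leq_trans (\sum_(q < s) #|[set u in S | H (v, q) (u, phi u)]|)).
    by rewrite /fsum; apply: leq_sum => q _; rewrite leqNgt.
  rewrite /degin -sum1_card [X in _ <= X]big_mkcond /=.
  under eq_bigr => q _ do rewrite -sum1_card big_mkcond /=.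
  rewrite exchange_big /=; apply: leq_sum => u _.
  under eq_bigr => q _ do rewrite inE.
  rewrite inE; case: (boolP (u \in S)) => uS /=; last by rewrite big1.
  rewrite -big_mkcond /= sum1_card.
  case: (pickP (fun q => H (v, q) (u, phi u))) => [q hq|h0]; last by rewrite eq_card0.
  rewrite (HE hq) (eq_card (B := pred1 q)) ?card1 // => r.
  apply/idP/eqP => [hr|->//]; rewrite Hsym in hq; rewrite /in_mem /= Hsym in hr.
  exact: Hmatch hr hq.
apply: (@colorableI _ _ (fun u => if u == v then q else phi u)).
apply: (@good_extend _ _ _ v) => //.
  by apply: good_weaken gd => // u; rewrite !inE => /andP[/negbTE->].
rewrite eqxx; congr (_ < _): lq; apply: eq_card => u; rewrite !inE eqxx.
by case: eqP => [->|//]; rewrite !Hloop.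
Qed.

Lemma conn_surplus S f v : conn e S -> v \in S -> degin e S v < fsum f v -> surplus S f.
Proof. by move=> /connP cS vS lt E sE E0 cE; exists v => //; rewrite (cS E sE E0 cE). Qed.

Lemma conn_tight S f : 0 < s -> conn e S -> feasible S f -> ~~ colorable S f ->
  forall v, v \in S -> fsum f v = degin e S v.
Proof.
move=> s0 cS fe nc v vS; apply/eqP; rewrite eqn_leq fe // andbT leqNgt.
by apply: contra nc => lt; apply: surplus_colorable => //; apply: conn_surplus lt.
Qed.

Lemma kernel_nbr S f v c u : 0 < s -> nocut e S -> feasible S f -> ~~ colorable S f ->
  v \in S -> u \in S -> e v u -> 0 < f (v, c) ->
  exists2 q, H (v, c) (u, q) & 0 < f (u, q).
Proof.
move=> s0 /nocutP[cS cSv] fe nc vS uS evu fc.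
have tS := conn_tight s0 cS fe nc uS.
have nc' : ~~ colorable (S :\ v) (reduce f v c).
  by apply: contra nc; apply: colorable_reduce.
have uSv : u \in S :\ v by rewrite !inE uS andbT; apply: contraTneq evu => ->; rewrite eirr.
have := conn_tight s0 (cSv v vS) (feasible_reduce c vS fe) nc' uSv.
rewrite fsum_reduce // tS (degin_D1 _ _ vS) esym evu.
case: existsP => [[q /andP[]]|_]; first by exists q.
by lia.
Qed.

Lemma nocut_match S f v c u q : 0 < s -> nocut e S -> feasible S f -> ~~ colorable S f ->
  v \in S -> u \in S -> H (v, c) (u, q) -> 0 < f (v, c) -> 0 < f (u, q).
Proof.
move=> s0 ncS fe nc vS uS hvu fv.
have [r hr fr] := kernel_nbr s0 ncS fe nc vS uS (HE hvu) fv.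
by rewrite (Hmatch hvu hr).
Qed.

Definition kcolors f v : nat := #|[set q | 0 < f (v, q)]|.

Lemma kcolors_le S f v u : 0 < s -> nocut e S -> feasible S f -> ~~ colorable S f ->
  v \in S -> u \in S -> e v u -> kcolors f v <= kcolors f u.
Proof.
move=> s0 ncS fe nc vS uS evu.
pose h q := odflt q [pick r | H (v, q) (u, r)].
have hP q : 0 < f (v, q) -> H (v, q) (u, h q) /\ 0 < f (u, h q).
  move=> fq; have [r hr fr] := kernel_nbr s0 ncS fe nc vS uS evu fq.
  rewrite /h; case: pickP => [r' hr'|/(_ r)]; last by rewrite hr.
  by rewrite /= (Hmatch hr' hr).
rewrite /kcolors -(@card_in_imset _ _ h).
  apply: subset_leq_card; apply/subsetP => r /imsetP[q]; rewrite inE => fq ->.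
  by rewrite inE; case: (hP q fq).
move=> q q'; rewrite !inE => /hP[h1 _] /hP[h2 _] eqh; move: h1 h2.
by rewrite eqh [H (v, q) _]Hsym [H (v, q') _]Hsym => h1 h2; apply: Hmatch h1 h2.
Qed.

Lemma kcolors_const S f v u : 0 < s -> nocut e S -> feasible S f -> ~~ colorable S f ->
  v \in S -> u \in S -> kcolors f v <= kcolors f u.
Proof.
move=> s0 ncS fe nc vS; have [/connP cS _] := nocutP _ _ ncS.
have <- : [set w in S | kcolors f v <= kcolors f w] = S.
  apply: cS; first by apply/subsetP => x; rewrite inE => /andP[].
    by apply/set0Pn; exists v; rewrite inE vS /=.
  apply/closed_inP => x y; rewrite !inE => /andP[xS lx] yS exy; rewrite yS /=.
  by apply: leq_trans lx _; exact: (kcolors_le s0 ncS fe nc xS yS exy).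
by rewrite inE => /andP[].
Qed.

Lemma leq_fsum f v a : f (v, a) <= fsum f v.
Proof. by rewrite /fsum (bigD1 a) //= leq_addr. Qed.

Lemma kcolors_multi f v a : 1 < kcolors f v -> f (v, a) < fsum f v.
Proof.
move=> k1; have [b ba fb] : exists2 b : 'I_s, b != a & 0 < f (v, b).
  apply/exists_inP; apply: contraLR k1 => nex; rewrite -leqNgt.
  apply: leq_trans (_ : #|[set a]| <= 1); last by rewrite cards1.
  apply: subset_leq_card; apply/subsetP => b; rewrite !inE => fb.
  by apply: contraNT nex => ba; apply/exists_inP; exists b.
rewrite /fsum (bigD1 a) //= (bigD1 b) //=; lia.
Qed.

(** Constancy on smaller sets, applied to reduced budgets, forces matching edges to be transitive,
    and transitivity gives constancy on [S]. Together the two claims make the kernel a union of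
    cliques with one value on each. *)
Lemma complete_kernel S f : 0 < s -> complete_on e S -> feasible S f -> ~~ colorable S f ->
  (forall v w a b, v \in S -> w \in S -> H (v, a) (w, b) -> 0 < f (v, a) ->
     f (w, b) = f (v, a)) /\
  (forall v w u a b c, v \in S -> w \in S -> u \in S -> v != u ->
     H (v, a) (w, b) -> H (w, b) (u, c) -> 0 < f (v, a) -> H (v, a) (u, c)).
Proof.
move=> s0; move: {2}#|S| (leqnn #|S|) => n; elim: n S f => [|n IH] S f.
  rewrite leqn0 cards_eq0 => /eqP-> _ _ _; split=> v w.
    by move=> a b; rewrite inE.
  by move=> u a b c; rewrite inE.
move=> cS coS fe nc; have ncS := complete_nocut coS.
have tight := conn_tight s0 (proj1 (nocutP _ _ ncS)) fe nc.
have match_pos v c u q : v \in S -> u \in S -> H (v, c) (u, q) -> 0 < f (v, c) -> 0 < f (u, q).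
  exact: nocut_match.
have nbr v c u : v \in S -> u \in S -> v != u -> 0 < f (v, c) -> exists q, H (v, c) (u, q).
  move=> vS uS vu fc; have evu := complete_onP _ _ coS v u vS uS vu.
  by have [q hq _] := kernel_nbr s0 ncS fe nc vS uS evu fc; exists q.
have red x c v w a b : x \in S -> 0 < f (x, c) -> v \in S :\ x -> w \in S :\ x ->
    H (v, a) (w, b) -> 0 < reduce f x c (v, a) -> reduce f x c (w, b) = reduce f x c (v, a).
  move=> xS fx vS wS hvw fv; have [] := IH (S :\ x) (reduce f x c).
  - by move: cS; rewrite (cardsD1 x) xS.
  - exact: complete_onS (subD1set _ _) coS.
  - exact: feasible_reduce.
  - by apply: contra nc; apply: colorable_reduce.
  - by move=> h _; apply: h.
(* Choosing [(v, a)] lowers the budget of [(w, b)] but not that of [(u, c)]; these two are matched,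
   so they must agree after the reduction. *)
have peak v w u a b c : v \in S -> w \in S -> u \in S -> v != u ->
    H (v, a) (w, b) -> H (w, b) (u, c) -> 0 < f (v, a) -> ~~ H (v, a) (u, c) ->
    f (w, b) = (f (u, c)).+1.
  move=> vS wS uS vu hvw hwu fv nvu.
  have wv : w != v by apply: contraTneq hvw => ->; rewrite Hloop.
  have fw := match_pos _ _ _ _ vS wS hvw fv.
  have fu := match_pos _ _ _ _ wS uS hwu fw.
  have := red v a u w c b vS fv; rewrite !inE wv (eq_sym u) vu wS uS Hsym hwu.
  by rewrite /reduce hvw (negbTE nvu) subn0 fu => /(_ isT isT isT isT) <-; rewrite subn1 prednK.
(* Read from its other end, the open path makes [f (w, b)] exceed [f (v, a)] by one. The neighbour
   [(u, d)] of [(v, a)] starts another open path, which makes [f (v, a)] exceed [f (w, b)] by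
   one. *)
have trans v w u a b c : v \in S -> w \in S -> u \in S -> v != u ->
     H (v, a) (w, b) -> H (w, b) (u, c) -> 0 < f (v, a) -> H (v, a) (u, c).
  move=> vS wS uS vu hvw hwu fv; apply: contraT => nvu.
  have wu : w != u by apply: contraTneq hwu => ->; rewrite Hloop.
  have fw := match_pos _ _ _ _ vS wS hvw fv.
  have fu := match_pos _ _ _ _ wS uS hwu fw.
  have uv : u != v by rewrite eq_sym.
  have hwv : H (w, b) (v, a) by rewrite Hsym.
  have huw : H (u, c) (w, b) by rewrite Hsym.
  have := peak u w v c b a uS wS vS uv huw hwv fu; rewrite Hsym => /(_ nvu) e1.
  have [d hvd] := nbr v a u vS uS vu fv.
  have fd := match_pos _ _ _ _ vS uS hvd fv.
  have nwd : ~~ H (w, b) (u, d).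
    by apply: contra nvu => hwd; rewrite (Hmatch hwu hwd).
  have hdv : H (u, d) (v, a) by rewrite Hsym.
  have uw : u != w by rewrite eq_sym.
  have := peak u v w d a b uS vS wS uw hdv hvw fd; rewrite Hsym => /(_ nwd) e2.
  by clear -e1 e2; lia.
split=> // v w a b vS wS hvw fv.
have fw := match_pos _ _ _ _ vS wS hvw fv.
have vw : v != w by apply: contraTneq hvw => ->; rewrite Hloop.
(* A third vertex matched to both ends takes one unit from each, so equality after the reduction
   gives equality before it; if both reduced values vanish, both values were 1. With only two
   vertices, the degrees force the value 1. *)
case: (pickP (fun u => [&& u \in S, u != v & u != w])) => [u /and3P[uS uv uw]|h0].
  have wu : w != u by rewrite eq_sym.
  have vu : v != u by rewrite eq_sym.
  have [c hwc] := nbr w b u wS uS wu fw.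
  have hvc := trans v w u a b c vS wS uS vu hvw hwc fv.
  have fc := match_pos _ _ _ _ vS uS hvc fv.
  have hwv : H (w, b) (v, a) by rewrite Hsym.
  have := red u c v w a b uS fc; have := red u c w v b a uS fc.
  rewrite !inE vu wu vS wS hvw hwv /reduce ![H (u, c) _]Hsym hvc hwc.
  by move=> /(_ isT isT isT) h1 /(_ isT isT isT) h2; clear -h1 h2 fv fw; lia.
have d1 x y : x \in S -> y \in S -> x != y -> [set x; y] = [set v; w] -> degin e S x <= 1.
  move=> xS yS xy eq2; apply: leq_trans (_ : #|[set y]| <= 1); last by rewrite cards1.
  apply: subset_leq_card; apply/subsetP => z; rewrite !inE => /andP[zS exz].
  have : z \in [set x; y].
    by rewrite eq2 !inE; have := h0 z; rewrite zS /=; case: eqP; case: eqP.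
  by rewrite !inE => /orP[/eqP zx|//]; rewrite zx eirr in exz.
have lev := d1 v w vS wS vw erefl.
have wv : w != v by rewrite eq_sym.
have lew := d1 w v wS vS wv (setUC _ _).
have := leq_fsum f v a; have := leq_fsum f w b.
rewrite !tight // => h1 h2; clear -h1 h2 lev lew fv fw; lia.
Qed.

(** * Splitting a critical cover at a cut vertex *)

Definition set_fibre f c (k : 'I_s -> nat) : T * 'I_s -> nat :=
  fun x => if x.1 == c then k x.2 else f x.

Lemma set_fibre_eq f c k q : set_fibre f c k (c, q) = k q.
Proof. by rewrite /set_fibre eqxx. Qed.

Lemma set_fibre_neq f c k u q : u != c -> set_fibre f c k (u, q) = f (u, q).
Proof. by rewrite /set_fibre /= => /negbTE->. Qed.

Lemma fsum_set_fibre f c k : fsum (set_fibre f c k) c = \sum_(q < s) k q.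
Proof. by apply: eq_bigr => q _; rewrite set_fibre_eq. Qed.

Lemma fsum_set_fibre_neq f c k u : u != c -> fsum (set_fibre f c k) u = fsum f u.
Proof. by move=> uc; apply: eq_bigr => q _; rewrite set_fibre_neq. Qed.

(* [g q] is the largest budget at [(c, q)] for which no good colouring of [S]
   chooses [q] at [c]. *)
Lemma critical_budget S f c : 0 < s -> conn e S -> c \in S ->
  (forall u, u \in S -> u != c -> degin e S u <= fsum f u) ->
  exists g : 'I_s -> nat,
    [/\ ~~ colorable S (set_fibre f c g),
        forall q, exists2 phi, phi c = q & good S (set_fibre f c (fun=> (g q).+1)) phi
      & \sum_(q < s) g q <= degin e S c].
Proof.
move=> s0 cS cinS fe.
have [phi0 gd0] : exists phi, good (S :\ c) f phi.
  suff /existsP[phi] : colorable (S :\ c) f by exists phi.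
  apply: surplus_colorable => //.
    move=> u; rewrite !inE => /andP[uc uS].
    exact: leq_trans (degin_sub _ _ (subD1set _ _)) (fe u uS uc).
  move=> E sE E0 clE; have sES : E \subset S by apply: subset_trans sE (subD1set _ _).
  have cE : c \notin E by apply/negP => /(subsetP sE); rewrite !inE eqxx.
  have [u uE euc] : exists2 u, u \in E & e u c.
    apply/exists_inP; apply: contraT => nex; have ES : E = S.
      apply: (connP _ _ cS) => //; apply/closed_inP => x y xE yS exy.
      apply: (closed_inP _ _ _ clE x) => //; rewrite !inE yS andbT.
      by apply: contraNneq nex => yc; apply/exists_inP; exists x; rewrite -?yc.
    by rewrite ES cinS in cE.
  have uS := subsetP sES u uE; exists u => //.
  have uc : u != c by apply: contraNneq cE => <-.
  by have := fe u uS uc; rewrite (degin_D1 _ _ cinS) euc.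
pose ok (q : 'I_s) k := [exists phi : {ffun T -> 'I_s},
  (phi c == q) && good S (set_fibre f c (fun=> k)) phi].
have okP q : exists k, ok q k.
  (* This budget exceeds every degree, so [c] can be removed first, whatever its layer. *)
  exists #|T|.+1; apply/existsP; exists [ffun u => if u == c then q else phi0 u].
  rewrite ffunE !eqxx /=; apply: (@good_extend _ _ _ c) => //; last first.
    by rewrite ffunE eqxx set_fibre_eq ltnS max_card.
  apply: good_weaken gd0 => // u; rewrite !inE => /andP[uc _].
    by rewrite ffunE (negbTE uc).
  by rewrite set_fibre_neq.
pose m q := ex_minn (okP q).
have m_ok q : ok q (m q) by rewrite /m; case: ex_minnP.
have m_min q k : ok q k -> m q <= k by rewrite /m; case: ex_minnP => ? _; apply.
(* The set consisting of [c] alone already needs a positive budget, so the predecessor of [m q] is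
   the largest budget that still fails. *)
have m_gt0 q : 0 < m q.
  rewrite lt0n; apply/eqP => m0; have := m_ok q; rewrite m0 => /existsP[phi /andP[_ /goodP]].
  move=> /(_ [set c]); rewrite sub1set cinS => /(_ isT)[|v /set1P->].
    by apply/set0Pn; exists c; rewrite inE.
  by rewrite set_fibre_eq ltn0.
have ncg : ~~ colorable S (set_fibre f c (fun q => (m q).-1)).
  apply/negP => /existsP[phi gd].
  suff : m (phi c) <= (m (phi c)).-1 by have := m_gt0 (phi c); clear; lia.
  apply: m_min; apply/existsP; exists phi; rewrite eqxx /=.
  apply: good_weaken gd => // v _; case: (eqVneq v c) => [->|vc].
    by rewrite !set_fibre_eq.
  by rewrite !set_fibre_neq.
exists (fun q => (m q).-1); split=> // [q|].
  have /existsP[phi /andP[/eqP h1 h2]] := m_ok q; exists phi => //.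
  by rewrite prednK.
rewrite leqNgt; apply: contra ncg => lt; apply: surplus_colorable => //.
  move=> u uS; case: (eqVneq u c) => [->|uc].
    by rewrite fsum_set_fibre ltnW.
  by rewrite fsum_set_fibre_neq ?fe.
by apply: conn_surplus cinS _ => //; rewrite fsum_set_fibre.
Qed.

(** Colourings of the two sides with budgets one above critical can take the same layer at [c] and
    be glued, so [f (c, q)] is at most [g1 q + g2 q]. Summed over [q], the critical budgets are at
    most the degree of [c], hence at most [fsum f c], so all these inequalities are equalities. *)
Lemma split_cut S f c E : 0 < s -> conn e S -> feasible S f -> ~~ colorable S f ->
  c \in S -> E \subset S :\ c -> closed_in e (S :\ c) E ->
  exists g1 g2 : 'I_s -> nat,
    [/\ feasible (c |: E) (set_fibre f c g1) /\ ~~ colorable (c |: E) (set_fibre f c g1),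
        feasible (S :\: E) (set_fibre f c g2) /\ ~~ colorable (S :\: E) (set_fibre f c g2)
      & forall q, f (c, q) = g1 q + g2 q].
Proof.
move=> s0 cS fe nc cinS sE clE.
have cE : c \notin E by apply/negP => /(subsetP sE); rewrite !inE eqxx.
have sES : E \subset S by apply: subset_trans sE (subD1set _ _).
have S2E : S :\: E = c |: (S :\ c :\: E).
  apply/setP => x; rewrite !inE; case: (eqVneq x c) => [->|] //=.
  by rewrite cinS cE.
have cS1 : conn e (c |: E) by apply: (conn_branch esym cS cinS sE clE).
have cS2 : conn e (S :\: E).
  by rewrite S2E; apply: (conn_branch esym cS cinS (subsetDl _ _)); exact: closed_inC.
have sS1 : c |: E \subset S by rewrite subUset sub1set cinS.
have sS2 : S :\: E \subset S by apply: subsetDl.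
have cS1in : c \in c |: E by rewrite !inE eqxx.
have cS2in : c \in S :\: E by rewrite inE cE.
have fe1 S' u : S' \subset S -> u \in S' -> degin e S' u <= fsum f u.
  by move=> sS' uS; apply: leq_trans (degin_sub _ _ sS') (fe u (subsetP sS' u uS)).
have [g1 [nc1 ex1 le1]] := critical_budget s0 cS1 cS1in (fun u uS _ => fe1 _ u sS1 uS).
have [g2 [nc2 ex2 le2]] := critical_budget s0 cS2 cS2in (fun u uS _ => fe1 _ u sS2 uS).
have deg_c : degin e S c = degin e (c |: E) c + degin e (S :\: E) c.
  rewrite {1}/degin -(cardsID E); congr (_ + _); apply: eq_card => x; rewrite !inE.
    case: (eqVneq x c) => [->|_]; first by rewrite eirr (negbTE cE) !andbF.
    by case: (boolP (x \in E)) => xE; rewrite ?andbF ?andbT //= (subsetP sES x xE).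
  by rewrite andbA.
have le q : f (c, q) <= g1 q + g2 q.
  rewrite leqNgt; apply: contra nc => lt.
  have [p1 p1c /goodP gd1] := ex1 q; have [p2 p2c /goodP gd2] := ex2 q.
  pose p u := if u \in E then p1 u else p2 u.
  have pE1 : {in c |: E, p =1 p1}.
    by move=> u; rewrite !inE /p; case: (boolP (u \in E)) => // _ /orP[/eqP->|//]; rewrite p1c.
  have pE2 : {in S :\: E, p =1 p2} by move=> u; rewrite inE /p => /andP[/negbTE->].
  apply: (@colorableI _ _ p); apply/goodP => A sA A0.
  pose A1 := A :&: (c |: E); pose A2 := A :&: (S :\: E).
  have h1 : {in A1, p =1 p1} by move=> x; rewrite inE => /andP[_ /pE1].
  have h2 : {in A2, p =1 p2} by move=> x; rewrite inE => /andP[_ /pE2].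
  have d1 u : u \in A1 -> hdeg p1 A1 u = hdeg p A1 u.
    by move=> uA; apply: eq_hdeg => // x xA; rewrite h1.
  have d2 u : u \in A2 -> hdeg p2 A2 u = hdeg p A2 u.
    by move=> uA; apply: eq_hdeg => // x xA; rewrite h2.
  have full1 u : u \in E -> hdeg p A u = hdeg p A1 u.
    move=> uE; apply: eq_card => x; rewrite !inE.
    case: (boolP (H _ _)) => [/HE eux|]; rewrite ?andbF // !andbT.
    case: (boolP (x \in A)) => //= xA; symmetry; case: eqVneq => //= xc.
    apply: (closed_inP _ _ _ clE u) => //; rewrite !inE xc; exact: subsetP xA.
  have full2 u : u \in S :\: E -> u != c -> hdeg p A u = hdeg p A2 u.
    rewrite inE => /andP[uE uS] uc; apply: eq_card => x; rewrite !inE.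
    case: (boolP (H _ _)) => [/HE eux|]; rewrite ?andbF // !andbT.
    case: (boolP (x \in A)) => //= xA; rewrite (subsetP sA x xA) andbT; symmetry.
    apply: contra uE => xE; apply: (closed_inP _ _ _ clE x) => //; last by rewrite esym.
    by rewrite !inE uc.
  have E1 u : u \in A1 -> u != c -> u \in E by rewrite !inE => /andP[_ /orP[->|]].
  case: (eqVneq A1 set0) => [A10|A10].
    have A2A : A2 = A.
      apply/setP => x; rewrite !inE; case: (boolP (x \in A)) => //= xA.
      rewrite (subsetP sA x xA) andbT; apply/negP => xE.
      have : x \in A1 by rewrite !inE xA xE orbT.
      by rewrite A10 inE.
    have cA : c \notin A.
      by apply/negP => cA; have : c \in A1 by [rewrite !inE cA eqxx]; rewrite A10 inE.
    have [||u uA lu] := gd2 A2; first exact: subsetIr; first by rewrite A2A.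
    have uc : u != c by apply: contraNneq cA => <-; rewrite -A2A.
    exists u; first by rewrite -A2A.
    rewrite d2 // set_fibre_neq // -h2 // in lu.
    by rewrite A2A in lu.
  (* A removable vertex other than [c] has all its neighbours in its own part. If both parts yield
     [c], its degree is at most [g1 q + g2 q], and the strict inequality assumed on [f (c, q)] is
     spent here. *)
  have [|u uA lu] := gd1 A1 _ A10; first exact: subsetIr.
  have uAA : u \in A by move: uA; rewrite inE => /andP[].
  rewrite d1 // in lu; case: (eqVneq u c) => [uc|uc]; last first.
    exists u => //; rewrite full1; last exact: E1.
    by rewrite set_fibre_neq // -h1 // in lu.
  have {}uAA : c \in A by rewrite -uc.
  have [||v vA lv] := gd2 A2; first exact: subsetIr.
    by apply/set0Pn; exists c; rewrite inE uAA.
  rewrite d2 // in lv.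
  case: (eqVneq v c) => [vc|vc]; last first.
    exists v; first by move: vA; rewrite inE => /andP[].
    rewrite full2 //; last by move: vA; rewrite inE => /andP[].
    by rewrite set_fibre_neq // -h2 // in lv.
  exists c => //; rewrite uc set_fibre_eq in lu; rewrite vc set_fibre_eq in lv.
  have -> : p c = q by rewrite pE2.
  apply: leq_trans lt; rewrite ltnS.
  apply: (@leq_trans (hdeg p A1 c + hdeg p A2 c)); last by rewrite leq_add.
  apply: leq_trans (leq_card_setU _ _); apply: subset_leq_card; apply/subsetP => x.
  rewrite !inE => /andP[xA ->]; rewrite xA (subsetP sA x xA) !andbT /=.
  by case: (x \in E); rewrite ?orbT.
have sum_le : \sum_(q < s) (g1 q + g2 q) <= fsum f c.
  by rewrite big_split /=; apply: leq_trans (fe c cinS); rewrite deg_c leq_add.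
have eqg q : f (c, q) = g1 q + g2 q.
  have := leqif_sum (P := predT) (fun i _ => leqif_eq (le i)); case=> h1 h2.
  by apply/eqP; move: q; apply/forallP; rewrite -h2 eqn_leq h1.
have sg : fsum f c = \sum_(q < s) g1 q + \sum_(q < s) g2 q.
  by rewrite -big_split; apply: eq_bigr.
have := fe c cinS; rewrite deg_c sg => led.
exists g1, g2; split=> //; split=> // u uS; (case: (eqVneq u c) => [->|uc];
  [rewrite fsum_set_fibre; clear -led le1 le2; lia | rewrite fsum_set_fibre_neq // fe1 //]).
Qed.

(** * Base graphs whose kernel has at least two sheets *)

Lemma kernel_const S f v w a b : 0 < s -> nocut e S -> feasible S f -> ~~ colorable S f ->
  complete_on e S \/ (forall v, v \in S -> degin e S v = 2) ->
  1 < kcolors f v -> v \in S -> w \in S -> H (v, a) (w, b) -> 0 < f (v, a) ->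
  f (w, b) = f (v, a).
Proof.
move=> s0 ncS fe nc [coS|reg] k1 vS wS hvw fv.
  by have [h _] := complete_kernel s0 coS fe nc; apply: h.
(* In the 2-regular case each fibre has sum 2 spread over at least two layers, so all kernel values
   are 1. *)
have fw := nocut_match s0 ncS fe nc vS wS hvw fv.
have k2 := leq_trans k1 (kcolors_const s0 ncS fe nc vS wS).
have [cS _] := nocutP _ _ ncS.
have := kcolors_multi b k2; have := kcolors_multi a k1.
rewrite !(conn_tight s0 cS fe nc) // !reg // => h1 h2; clear -h1 h2 fv fw; lia.
Qed.

(** Induction makes a smaller set [B] complete or 2-regular, so that [kernel_const] applies there.
    Both hypotheses of [complete_or_2regular] are instances of [key]. *)
Lemma multi_structure S f v : 0 < s -> nocut e S -> feasible S f -> ~~ colorable S f ->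
  v \in S -> 1 < kcolors f v ->
  complete_on e S \/ (forall v, v \in S -> degin e S v = 2).
Proof.
move=> s0; move: {2}#|S| (leqnn #|S|) => n; elim: n S f v => [|n IH] S f v0.
  by rewrite leqn0 cards_eq0 => /eqP-> _ _ _; rewrite inE.
move=> cS ncS fe nc v0S k0.
have k_gt1 u : u \in S -> 1 < kcolors f u.
  by move=> uS; apply: leq_trans k0 (kcolors_const s0 ncS fe nc v0S uS).
have [cnS cSv] := nocutP _ _ ncS.
(* For [w], [u] in [I] with [w] adjacent to [v] and [u] not, choosing at [v] the
   colour matched or not matched to [(w, a)] changes [f (w, a)] but not
   [f (u, b)], while both choices leave a critical [B]. *)
have key v (I B : {set T}) x : v \in S -> I \subset B -> B \subset S :\ v -> nocut e B -> conn e I ->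
    (forall c, 0 < f (v, c) -> exists2 g, feasible B g /\ ~~ colorable B g &
       forall u q, u \in I -> g (u, q) = reduce f v c (u, q)) ->
    (exists2 y, y \in I & e v y) -> x \in I -> e v x.
  move=> vS sIB sB ncB cI exg [y yI evy] xI; apply: contraT => nevx.
  have [w wI [u [uI ewu evw nevu]]] : exists2 w, w \in I &
      exists u, [/\ u \in I, e w u, e v w & ~~ e v u].
    have : ~~ closed_in e I [set w in I | e v w].
      apply/negP => cl; have EI : [set w in I | e v w] = I.
        apply: (connP _ _ cI) => //; first by apply/subsetP => z; rewrite inE => /andP[].
        by apply/set0Pn; exists y; rewrite inE yI.
      by have : x \in [set w in I | e v w] by [rewrite EI]; rewrite inE (negbTE nevx) andbF.
    rewrite negb_forall => /existsP[w]; rewrite negb_imply inE => /andP[/andP[wI evw]].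
    rewrite negb_forall => /existsP[u]; rewrite !negb_imply inE => /and3P[uI ewu].
    by rewrite uI => nevu; exists w => //; exists u.
  have sBS : B \subset S by apply: subset_trans sB (subD1set _ _).
  have wB := subsetP sIB w wI; have uB := subsetP sIB u uI.
  have wS := subsetP sBS w wB; have uS := subsetP sBS u uB.
  have [c1 [c2 [c12 fc1 fc2]]] : exists c1 c2, [/\ c1 != c2, 0 < f (v, c1) & 0 < f (v, c2)].
    have := k_gt1 v vS; rewrite /kcolors => k1.
    have /card_gt1P[c1 [c2 []]] := k1; rewrite !inE => h1 h2 h3.
    by exists c1, c2.
  have [a ha fa] := kernel_nbr s0 ncS fe nc vS wS evw fc1.
  have [b hb fb] := kernel_nbr s0 ncS fe nc wS uS ewu fa.
  have budget c : 0 < f (v, c) -> reduce f v c (w, a) = f (u, b).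
    move=> fc; have [g [feB ncolB] gI] := exg c fc.
    have gu q : g (u, q) = f (u, q).
      rewrite gI // /reduce; case: (boolP (H _ _)) => [/HE|_]; last by rewrite subn0.
      by rewrite (negbTE nevu).
    have ku : 1 < kcolors g u.
      have := k_gt1 u uS; congr (_ < _); apply: eq_card => q; by rewrite !inE gu.
    have ltB : #|B| <= n.
      by have := subset_leq_card sB; move: cS; rewrite (cardsD1 v) vS; clear; lia.
    have struc := IH B g u ltB ncB feB ncolB uB ku.
    rewrite -gI // -gu; apply: (kernel_const s0 ncB feB ncolB struc ku) => //.
      by rewrite Hsym.
    by rewrite gu.
  have := budget c1 fc1; have := budget c2 fc2; rewrite /reduce ha.
  case: (boolP (H (v, c2) _)) => [h2|_]; last by move: fa; clear; lia.
  by move: ha h2; rewrite [H (v, c1) _]Hsym [H (v, c2) _]Hsym => h1 h2; rewrite (Hmatch h1 h2) eqxx in c12.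
have red v c : v \in S -> 0 < f (v, c) ->
    feasible (S :\ v) (reduce f v c) /\ ~~ colorable (S :\ v) (reduce f v c).
  move=> vS fc; split; first exact: feasible_reduce.
  by apply: contra nc; apply: colorable_reduce.
apply: complete_or_2regular => //.
- move=> v x vS ncSv xS; apply: (key v (S :\ v) (S :\ v)) => //.
  + by have [] := nocutP _ _ ncSv.
  + by move=> c fc; exists (reduce f v c) => //; apply: red.
  apply/exists_inP; apply: contraT => nex.
  have vS1 : [set v] = S.
    apply: (connP _ _ cnS); rewrite ?sub1set //; first by apply/set0Pn; exists v; rewrite inE.
    apply/closed_inP => z y; rewrite !inE => /eqP-> yS evy; apply: contraNT nex => yv.
    by apply/exists_inP; exists y; rewrite ?inE ?yv.
  by rewrite -vS1 !inE andNb in xS.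
(* Splitting off the end block changes the budget only at [d], which is not in [I]; this is why
   [key] distinguishes [I] from the block [d |: I]. *)
- move=> v I d x vS lI xI; have [sI I0 dI clI ncB] := lI.
  have [dI' dS] : d \notin I /\ d \in S :\ v by move: dI; rewrite inE => /andP[].
  have [cB cBd] := nocutP _ _ ncB.
  have sId : I \subset S :\ v :\ d by rewrite subsetD1 sI.
  apply: (key v I (d |: I)) => //.
  + exact: subsetUr.
  + by rewrite subUset sub1set dS.
  + have <- : (d |: I) :\ d = I by rewrite setU1K.
    by apply: cBd; rewrite !inE eqxx.
  + move=> c fc; have [feR ncR] := red v c vS fc.
    have [g1 [g2 [h1 _ _]]] := split_cut s0 (cSv v vS) feR ncR dS sId clI.
    exists (set_fibre (reduce f v c) d g1) => // u q uI; rewrite set_fibre_neq //.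
    by apply: contraNneq dI' => <-.
  (* Without a neighbour of [v], the set [I] would be closed in [S :\ d] and hence equal to it, but
     it misses [v]. *)
  apply/exists_inP; apply: contraT => nex.
  have dSS : d \in S by move: dS; rewrite !inE => /andP[].
  have ISd : I = S :\ d.
    apply: (connP _ _ (cSv d dSS)) => //.
      by apply: subset_trans sId _; rewrite setSD // subD1set.
    apply/closed_inP => z y zI yS ezy; case: (eqVneq y v) => [yv|yv].
      case/negP: nex; apply/exists_inP; exists z => //; rewrite esym -yv //.
    apply: (closed_inP _ _ _ clI z) => //; move: yS; rewrite !inE => /andP[-> ->].
    by rewrite yv.
  have : v \in I.
    by rewrite ISd !inE vS andbT; apply: contraTneq dS => <-; rewrite !inE eqxx.
  by move/(subsetP sI); rewrite !inE eqxx.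
Qed.

End Colouring.

(** * Transversals and subtypes *)

Section Transversals.
Variables (s : nat) (T : finType) (H : rel (T * 'I_s)) (f : T * 'I_s -> nat).
Hypothesis Hsimple : simple_graph H.

Lemma good_transversal (R : {set T * 'I_s}) (phi : T -> 'I_s) :
  (forall x, (x \in R) = (x.2 == phi x.1)) ->
  strictly_degenerate (induced (P := fun x => x \in R) H) (fun x => f (val x)) <->
  good H setT f phi.
Proof.
case: Hsimple => Hsym Hirr hR; pose U := {x : T * 'I_s | x \in R}.
have valE (x : U) : val x = ((val x).1, phi (val x).1).
  by have := valP x; rewrite hR => /eqP <-; case: (val x).
have fst_inj : injective (fun x : U => (val x).1).
  by move=> x y exy; apply: val_inj; rewrite valE exy -valE.
have lift v : {x : U | val x = (v, phi v)}.
  have vR : (v, phi v) \in R by rewrite hR.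
  by exists (exist (fun x => x \in R) _ vR).
split=> [sd|/goodP gd].
  apply/goodP => A _ A0.
  pose A' := [set x : U | (val x).1 \in A].
  pose g := [rel x y : U | [&& x \in A', y \in A' & H (val x) (val y)]].
  have sub : is_subgraph A' g (induced (P := fun x => x \in R) H).
    split; last by move=> x y /and3P[].
    split=> [x y|x] /=; first by rewrite Hsym andbCA.
    by rewrite Hirr !andbF.
  have A'0 : A' != set0.
    case/set0Pn: A0 => v vA; have [x xv] := lift v.
    by apply/set0Pn; exists x; rewrite inE xv.
  have [x xA lt] := sd A' g sub A'0; exists (val x).1; first by rewrite inE in xA.
  rewrite -valE; apply: leq_ltn_trans lt.
  rewrite /deg -(card_imset _ fst_inj); apply: subset_leq_card; apply/subsetP => u.
  rewrite inE -valE => /andP[uA hux]; have [y yu] := lift u.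
  apply/imsetP; exists y; last by rewrite yu.
  rewrite inE; apply/and3P; split=> //; first by rewrite inE yu.
  by rewrite yu.
move=> A g [_ sub] A0.
pose A1 := [set (val x).1 | x in A].
have A10 : A1 != set0.
  by case/set0Pn: A0 => x xA; apply/set0Pn; exists (val x).1; apply: imset_f.
have [v /imsetP[x xA vx] lt] := gd A1 (subsetT _) A10; rewrite {v}vx in lt; exists x => //.
rewrite valE; apply: leq_ltn_trans lt.
rewrite /deg -(card_imset _ fst_inj); apply: subset_leq_card; apply/subsetP => u /imsetP[y].
move=> gxy -> {u}; rewrite inE in gxy; have [_ yA hxy] := sub x y gxy.
by rewrite inE -!valE; apply/andP; split=> //; apply: imset_f.

Qed.

Lemma transversal_colorable : 0 < s ->
  (exists R, strictly_degenerate_transversal H f R) <-> colorable H setT f.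
Proof.
move=> s0; split=> [[R [tR sd]]|/existsP[phi gd]].
  (* The default is never reached, since a transversal meets every fibre. *)
  pose phi v := odflt (Ordinal s0) [pick q | (v, q) \in R].
  suff hR x : (x \in R) = (x.2 == phi x.1).
    by apply: (@colorableI _ _ _ _ _ phi); apply/(good_transversal hR).
  case: x => v q /=.
  have /eqP/cards1P[x xE] := tR v.
  have uniqR r : (v, r) \in R -> x = (v, r).
    move=> vr; have : (v, r) \in R :&: [set y | y.1 == v] by rewrite !inE vr eqxx.
    by rewrite xE inE => /eqP.
  have xR : x \in R :&: [set y | y.1 == v] by rewrite xE inE.
  rewrite /phi; case: pickP => [r vr|none] /=.
    by apply/idP/eqP => [/uniqR xq|->//]; have := uniqR _ vr; rewrite xq => -[].
  by move: xR; rewrite !inE => /andP[xR /eqP xv]; have := none x.2; rewrite -xv -surjective_pairing xR.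
pose R := [set x : T * 'I_s | x.2 == phi x.1].
exists R; split; last by apply/(good_transversal (phi := phi)) => // x; rewrite inE.
move=> v; apply/eqP/cards1P; exists (v, phi v); apply/setP => -[u q].
by rewrite !inE xpair_eqE /= andbC; case: eqVneq => [->|].
Qed.

End Transversals.

Section Subtypes.
Variables (s : nat) (T : finType) (e : rel T).

Lemma degin_setT v : degin e setT v = deg e v.
Proof. by apply: eq_card => x; rewrite !inE. Qed.

Lemma conn_connect (P : pred T) : conn e [set x | P x] ->
  forall x y, connect (induced (P := P) e) x y.
Proof.
move=> cS x y; pose E := [set val z | z in [set z | connect (induced (P := P) e) x z]].
have ES : E = [set x | P x].
  apply: (connP _ _ cS).
  - by apply/subsetP => _ /imsetP[z _ ->]; rewrite inE (valP z).
  - by apply/set0Pn; exists (val x); apply: imset_f; rewrite inE connect0.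
  apply/closed_inP => _ u /imsetP[z zE ->]; rewrite inE => Pu ezu.
  apply/imsetP; exists (exist (fun x => P x) u Pu) => //; move: zE; rewrite !inE => zE.
  by apply: connect_trans zE _; apply: connect1.
have : val y \in E by rewrite ES inE (valP y).
by case/imsetP => z; rewrite inE => xz /val_inj->.
Qed.

Lemma conn_connectT : conn e setT -> forall x y, connect e x y.
Proof.
move=> cS x y; have ES : [set z | connect e x z] = setT.
  apply: (connP _ _ cS) => //; first by apply/set0Pn; exists x; rewrite inE connect0.
  apply/closed_inP => z u; rewrite !inE => xz _ ezu.
  by apply: connect_trans xz _; apply: connect1.
by have := in_setT y; rewrite -ES inE.
Qed.

Lemma connect_conn : (forall x y, connect e x y) -> conn e setT.
Proof.
move=> ce; apply/connP => E _ /set0Pn[x xE] /closed_inP cE; apply/setP => y; rewrite inE.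
have /connectP[p] := ce x y; elim: p x xE {ce} => [|z p IH] x xE /=; first by move=> _ ->.
by case/andP => exz; apply: IH; apply: cE xE _ exz.
Qed.

Variables (S : {set T}) (H : rel (T * 'I_s)) (f : T * 'I_s -> nat).
Let U := {x : T | x \in S}.
Let HU : rel (U * 'I_s) := fun x y => H (val x.1, x.2) (val y.1, y.2).
Let fU : U * 'I_s -> nat := fun x => f (val x.1, x.2).

Lemma deg_induced (x : U) : deg (induced (P := fun x => x \in S) e) x = degin e S (val x).
Proof.
rewrite /deg -(card_imset _ val_inj); apply: eq_card => u; apply/imsetP/idP.
  by case=> y; rewrite !inE => exy ->; rewrite (valP y).
by rewrite inE => /andP[uS exu]; exists (exist (fun x => x \in S) u uS); rewrite ?inE.
Qed.

Lemma colorable_induced : 0 < s -> colorable HU setT fU -> colorable H S f.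
Proof.
move=> s0 /existsP[phi /goodP gd].
pose psi u := if insub u is Some x then phi (x : U) else Ordinal s0.
have psiE (x : U) : psi (val x) = phi x by rewrite /psi valK.
apply: (@colorableI _ _ _ _ _ psi); apply/goodP => A sA A0.
have [||v] := gd [set x : U | val x \in A] => //.
  case/set0Pn: A0 => u uA; apply/set0Pn.
  by exists (exist (fun x => x \in S) u (subsetP sA u uA)); rewrite inE.
rewrite inE => vA lt; exists (val v) => //; rewrite psiE; apply: leq_ltn_trans lt.
rewrite /hdeg -(card_imset _ val_inj); apply: subset_leq_card; apply/subsetP => u.
rewrite inE => /andP[uA huv]; apply/imsetP.
exists (exist (fun x => x \in S) u (subsetP sA u uA)) => //; rewrite !inE uA /=.
by rewrite /HU /= -!psiE.
Qed.

End Subtypes.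

(** * Two-regular graphs *)

Lemma isomorphic_sym (T U : finType) (e : rel T) (e' : rel U) :
  isomorphic e e' -> isomorphic e' e.
Proof.
by case=> phi [psi phiK psiK] he; exists psi => [|x y]; [exists phi | rewrite -he !psiK].
Qed.

Lemma ordS_val n (i : 'I_n) : ordS i = (if i.+1 < n then i.+1 else 0) :> nat.
Proof.
rewrite /=; case: ifP => [/modn_small//|h].
by have -> : i.+1 = n; [have := ltn_ord i; lia | rewrite modnn].
Qed.

Lemma ordSS_neq n (i : 'I_n) : 2 < n -> ordS (ordS i) != i.
Proof.
move=> n3; apply/eqP => /(congr1 (@nat_of_ord n)); rewrite !ordS_val.
by have := ltn_ord i; case: (ltnP i.+1 n) => h1 h2; case: ifP; lia.
Qed.

Lemma cycle_graphE n (i j : 'I_n) : cycle_graph i j = (ordS i == j) || (ordS j == i).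
Proof. by []. Qed.

Section CycleEnumeration.
Variables (T : finType) (e : rel T).
Hypotheses (esym : symmetric e) (eirr : irreflexive e).
Hypothesis econn : conn e setT.
Hypothesis reg2 : forall v, degin e setT v = 2.

(** A path is extended at its head until both neighbours of the head lie on it. One of them differs
    from the second vertex and closes a cycle of length at least 3. The induction is on the room
    left, bounded by [n]. *)
Lemma cycle_exists (x0 : T) : exists c : seq T, [/\ uniq c, 2 < size c & cycle e c].
Proof.
suff ext n x p : #|T| - size p <= n -> uniq (x :: p) -> path e x p ->
    exists c : seq T, [/\ uniq c, 2 < size c & cycle e c].
  exact: (ext _ x0 [::] (leqnn _)).
elim: n x p => [|n IH] x p szp unip pathp.
  have := uniq_leq_size unip (fun y _ => mem_enum T y); rewrite -cardE /=.
  by move: szp; rewrite leqn0 subn_eq0 leqNgt => /negbTE->.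
have /cards2P[a [b [ab nbr]]] : #|[set u in setT | e x u]| == 2 by apply/eqP/reg2.
have nE u : e x u = (u == a) || (u == b).
  by have : (u \in [set u in setT | e x u]) = (u \in [set a; b]); [rewrite nbr | rewrite !inE].
have grow u : e x u -> u \notin x :: p -> exists c : seq T, [/\ uniq c, 2 < size c & cycle e c].
  move=> exu up; apply: (IH u (x :: p)) => /=; first by move: szp; rewrite subnS; case: (_ - _).
    by move: up unip; rewrite /= => -> /=.
  by rewrite esym exu.
have exa : e x a by rewrite nE eqxx.
have exb : e x b by rewrite nE eqxx orbT.
case: (boolP (a \in x :: p)) => [ain|/grow]; last exact.
case: (boolP (b \in x :: p)) => [bin|/grow]; last exact.
case: p unip pathp ain bin {szp grow} => [|z p] unip pathp.
  by rewrite !inE => /eqP ax; rewrite ax eirr in exa.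
have [c [ec cx cz]] : exists c, [/\ e x c, c != x & c != z].
  case: (eqVneq a z) => az; last first.
    by exists a; split=> //; apply: contraTneq exa => ->; rewrite eirr.
  exists b; split=> //; first by apply: contraTneq exb => ->; rewrite eirr.
  by rewrite -az eq_sym.
move=> ain bin; have cp : c \in p.
  have : c \in x :: z :: p by move: ec; rewrite nE => /orP[/eqP->|/eqP->].
  by rewrite !inE (negbTE cx) (negbTE cz).
case/splitPr: cp unip pathp {ain bin} => p1 p2 unip pathp.
exists (x :: z :: rcons p1 c); split.
- move: unip; rewrite -cat_rcons -!cat_cons cat_uniq; by case/and3P.
- by rewrite /= size_rcons.
rewrite (cycle_path x) /= last_rcons esym ec.
by move: pathp; rewrite -cat_rcons /= cat_path => /and3P[-> ->].
Qed.

(** Every vertex of the cycle found has its two neighbours on that cycle, so the cycle is closed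
    under adjacency and, by connectedness, exhausts the graph. *)
Lemma cycle_enumeration (x0 : T) : exists (n : nat) (theta : 'I_n -> T),
  [/\ 2 < n, bijective theta & forall i j, e (theta i) (theta j) = cycle_graph i j].
Proof.
have [c [unic sz3 cyc]] := cycle_exists x0.
pose n := size c; pose th (i : 'I_n) := nth x0 c i.
have thI : injective th by move=> i j /eqP; rewrite nth_uniq // => /eqP/val_inj.
have nextE d k : k < size c ->
    (if c is y :: p then nth y p k else d) = nth x0 c (if k.+1 < size c then k.+1 else 0).
  case: (c) => [|y p] //= kp; case: ifP => kp'; first exact: set_nth_default.
  by rewrite nth_default //; lia.
have arc i : e (th i) (th (ordS i)).
  have ic : th i \in c by apply: mem_nth.
  have := next_cycle cyc ic; congr (e _ _).
  by rewrite next_nth ic /th index_uniq // ordS_val nextE.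
have arc' i : e (th i) (th (ord_pred i)) by have := arc (ord_pred i); rewrite ord_predK esym.
have neq i : th (ordS i) != th (ord_pred i).
  apply/negP => /eqP/thI h; have := ordSS_neq (ord_pred i) sz3.
  by rewrite ord_predK h eqxx.
have nbr i y : e (th i) y = (y == th (ordS i)) || (y == th (ord_pred i)).
  have : [set th (ordS i); th (ord_pred i)] == [set u in setT | e (th i) u].
    rewrite eqEcard cards2 neq [#|_|]reg2 andbT; apply/subsetP => u.
    by rewrite !inE => /orP[/eqP->|/eqP->]; rewrite ?arc ?arc'.
  by move/eqP/setP => /(_ y); rewrite !inE /= => ->.
have surj y : exists i, y = th i.
  pose i0 : 'I_n := Ordinal (ltn_trans (isT : 0 < 2) sz3).
  have := in_setT y; have <- : [set th i | i in setT] = setT.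
    apply: (connP _ _ econn) => //; first by apply/set0Pn; exists (th i0); exact: imset_f (in_setT _).
    apply/closed_inP => _ u /imsetP[i _ ->] _; rewrite nbr.
    by case/orP => /eqP->; exact: imset_f (in_setT _).
  by case/imsetP => i _ ->; exists i.
exists n, th; split=> // [|i j].
  apply: inj_card_bij => //; rewrite -(card_imset _ thI).
  apply: subset_leq_card; apply/subsetP => y _; have [i ->] := surj y.
  exact: imset_f.
rewrite nbr cycle_graphE !(inj_eq thI) ![_ == ordS _]eq_sym; congr (_ || _).
by rewrite -(inj_eq (can_inj (@ordSK n))) ord_predK eq_sym.
Qed.

End CycleEnumeration.

(** * Building covers from critical covers without cut vertices *)

Lemma card_kernel (s : nat) (T : finType) (f : T * 'I_s -> nat) :
  #|{: {x : T * 'I_s | f x != 0}}| = \sum_(v : T) kcolors f v.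
Proof.
rewrite card_sig -sum1_card.
under [RHS]eq_bigr => v _ do rewrite /kcolors -sum1_card.
rewrite pair_big_dep /=; apply: eq_bigl => -[v q].
by rewrite !inE lt0n.
Qed.

Section BuildingCover.
Variables (s : nat) (T : finType) (e : rel T) (H : rel (T * 'I_s)).
Variable f : T * 'I_s -> nat.
Hypothesis s_gt0 : 0 < s.
Hypothesis T_gt1 : 1 < #|T|.
Hypothesis esimple : simple_graph e.
Hypothesis Hcover : is_cover e H.
Hypothesis encut : nocut e setT.
Hypothesis fdeg : feasible e setT f.
Hypothesis fcrit : ~~ colorable H setT f.

Let esym : symmetric e. Proof. by case: esimple. Qed.
Let eirr : irreflexive e. Proof. by case: esimple. Qed.
Let Hsym : symmetric H. Proof. by case: Hcover => -[]. Qed.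
Let HE u v q r : H (u, q) (v, r) -> e u v.
Proof. by case: Hcover => _ h _; apply: h. Qed.
Let Hmatch u v q r r' : H (u, q) (v, r) -> H (u, q) (v, r') -> r = r'.
Proof. by case: Hcover => _ _ h; apply: h. Qed.
Let econn : conn e setT. Proof. by case: (nocutP _ _ encut). Qed.

Let tight v : fsum f v = degin e setT v.
Proof. by apply: (conn_tight eirr Hsym (@HE) (@Hmatch) s_gt0 econn fdeg fcrit); rewrite inE. Qed.

Let nbr v u c : e v u -> 0 < f (v, c) -> exists2 q, H (v, c) (u, q) & 0 < f (u, q).
Proof.
by move=> evu; apply: (kernel_nbr esym eirr Hsym (@HE) (@Hmatch) s_gt0 encut fdeg fcrit); rewrite ?inE.
Qed.

Let match_pos v u c q : H (v, c) (u, q) -> 0 < f (v, c) -> 0 < f (u, q).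
Proof.
by apply: (nocut_match esym eirr Hsym (@HE) (@Hmatch) s_gt0 encut fdeg fcrit); rewrite ?inE.
Qed.

Let kcolorsE v u : kcolors f v = kcolors f u.
Proof.
by apply/eqP; rewrite eqn_leq !(kcolors_const esym eirr Hsym (@HE) (@Hmatch) s_gt0 encut fdeg fcrit) ?inE.
Qed.

Let kernel_eq_pos (x : {x : T * 'I_s | f x != 0}) : 0 < f ((val x).1, (val x).2).
Proof. by rewrite -surjective_pairing lt0n (valP x). Qed.

Lemma monoblock_of_single : (forall v, kcolors f v = 1) -> monoblock e H f.
Proof.
move=> k1; exists (fun x => (val x).1).
  apply: inj_card_bij; last first.
    by rewrite card_kernel (eq_bigr (fun=> 1)) ?sum1_card // => v _.
  move=> x y exy; apply: val_inj; have := k1 (val x).1; move/eqP/cards1P => [q qE].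
  have := kernel_eq_pos x; have := kernel_eq_pos y; rewrite -exy.
  have fE r : (0 < f ((val x).1, r)) = (r == q) by rewrite -in_set1 -qE inE.
  rewrite !fE => /eqP yq /eqP xq.
  by rewrite (surjective_pairing (val x)) xq exy -yq -surjective_pairing.
move=> x y; have fx := kernel_eq_pos x; have fy := kernel_eq_pos y; rewrite /kernel /induced /=.
rewrite (surjective_pairing (val x)) (surjective_pairing (val y)).
apply/idP/idP => [exy|/HE//]; have [q hq fq] := nbr exy fx.
have /eqP/cards1P[r rE] := k1 (val y).1.
have fE r' : (0 < f ((val y).1, r')) = (r' == r) by rewrite -in_set1 -rE inE.
by move: fy fq; rewrite !fE => /eqP-> /eqP <-.
Qed.

(** By transitivity of matching edges, a kernel vertex is determined by its base vertex and by the
    layer in which its clique meets the fixed fibre over [t0]. That layer is [base], and the copies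
    are indexed by the kernel layers [A] over [t0]. *)
Lemma complete_block_of_complete : complete_on e setT -> complete_block e H f.
Proof.
move=> coT; have [fconst trans] := complete_kernel esym eirr Hsym (@HE) (@Hmatch) s_gt0 coT fdeg fcrit.
have eE u v : e u v = (u != v).
  apply/idP/idP => [|uv]; first by apply: contraTneq => ->; rewrite eirr.
  by apply: (complete_onP _ _ coT); rewrite ?inE.
have [t0 _] : exists t0 : T, t0 \in T by apply/card_gt0P; exact: ltnW T_gt1.
pose A := [set q | 0 < f (t0, q)].
have [q0 q0A] : exists q0, q0 \in A.
  have : 0 < fsum f t0.
    rewrite tight; have /card_gt1P[a [b [_ _ ab]]] := T_gt1.
    apply/card_gt0P; exists (if a == t0 then b else a); rewrite !inE eE.
    by case: (eqVneq a t0) => [<-|at0]; rewrite ?eqxx // eq_sym.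
  rewrite lt0n sum_nat_eq0 negb_forall => /existsP[q]; rewrite negb_imply => /andP[_ fq].
  by exists q; rewrite inE lt0n.
pose base (x : T * 'I_s) := if x.1 == t0 then x.2 else odflt q0 [pick r | H x (t0, r)].
have baseP u q : 0 < f (u, q) ->
    base (u, q) \in A /\ (if u == t0 then base (u, q) = q else H (u, q) (t0, base (u, q))).
  move=> fq; rewrite /base /=; case: (eqVneq u t0) => [ut|ut]; first by rewrite inE -ut.
  have eut : e u t0 by rewrite eE.
  have [r hr fr] := nbr eut fq.
  case: pickP => [r' hr'|/(_ r)]; last by rewrite hr.
  by rewrite inE /= (Hmatch hr' hr).
have HbaseE u q u' q' : 0 < f (u, q) -> 0 < f (u', q') ->
    H (u, q) (u', q') = (base (u, q) == base (u', q')) && (u != u').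
  move=> fq fq'; have [_ b1] := baseP u q fq; have [_ b2] := baseP u' q' fq'.
  apply/idP/andP => [hh|[/eqP bb uu]].
    have uu : u != u' by rewrite -eE; apply: HE hh.
    split=> //; apply/eqP; move: b1 b2; case: (eqVneq u t0) => [ut ->|ut b1].
      rewrite -ut eq_sym (negbTE uu) => h2; rewrite Hsym in hh.
      by rewrite (Hmatch h2 hh).
    have b1' : H (t0, base (u, q)) (u, q) by rewrite Hsym.
    case: (eqVneq u' t0) => [ut' ->|ut' b2]; first by move: hh; rewrite ut' => hh; apply: Hmatch b1 hh.
    have hh' : H (u', q') (u, q) by rewrite Hsym.
    have h3 := trans u' u t0 q' q _ (in_setT _) (in_setT _) (in_setT _) ut' hh' b1 fq'.
    exact: Hmatch h3 b2.
  move: b1 b2; case: (eqVneq u t0) => [ut bq|ut b1].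
    by rewrite -ut eq_sym (negbTE uu) -bb bq Hsym.
  case: (eqVneq u' t0) => [ut' bq|ut' b2]; first by rewrite ut' -bq -bb.
  rewrite -bb Hsym in b2.
  exact: (trans u t0 u' q _ q' (in_setT _) (in_setT _) (in_setT _) uu b1 b2 fq).
exists #|T|, #|A|; split=> //.
- exists enum_rank; first by exists enum_val; [exact: enum_rankK | exact: enum_valK].
  by move=> x y; rewrite eE /complete_graph /= (inj_eq enum_rank_inj).
- pose phi (x : {x : T * 'I_s | f x != 0}) :=
    (enum_rank (val x).1, enum_rank_in q0A (base (val x))).
  have baseA (x : {x : T * 'I_s | f x != 0}) : base (val x) \in A.
    by have [] := baseP _ _ (kernel_eq_pos x); rewrite -surjective_pairing.
  have phi2 (x y : {x : T * 'I_s | f x != 0}) : ((phi x).2 == (phi y).2) = (base (val x) == base (val y)).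
    apply/eqP/eqP => [/= h|/= -> //].
    by rewrite -(enum_rankK_in q0A (baseA x)) h (enum_rankK_in q0A (baseA y)).
  exists phi.
    apply: inj_card_bij; last first.
      rewrite card_prod !card_ord card_kernel (eq_bigr (fun=> #|A|)) ?sum_nat_const //.
      by move=> v _; rewrite (kcolorsE v t0).
    move=> x y exy; apply: val_inj.
    have /eqP := congr1 snd exy; rewrite phi2 => /eqP b12.
    have u12 : (val x).1 = (val y).1 by apply: enum_rank_inj; have := congr1 (@fst _ _) exy.
    have [_ bx] := baseP _ _ (kernel_eq_pos x); have [_ by'] := baseP _ _ (kernel_eq_pos y).
    rewrite [LHS]surjective_pairing [RHS]surjective_pairing u12; congr pair.
    have bE (z : T * 'I_s) : base (z.1, z.2) = base z by rewrite -surjective_pairing.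
    move: bx by'; rewrite !bE b12 u12; case: ifP => [_ <- <-//|_].
    rewrite Hsym [H (_, (val y).2) _]Hsym => h1 h2.
    exact: Hmatch h1 h2.
  move=> x y; have phi1 : ((phi x).1 == (phi y).1) = ((val x).1 == (val y).1).
    exact: inj_eq enum_rank_inj _ _.
  transitivity (((phi x).2 == (phi y).2) && ((phi x).1 != (phi y).1)).
    by rewrite /complete_copies /cartesian [LHS]/= andbF.
  rewrite phi1 phi2; have := HbaseE _ _ _ _ (kernel_eq_pos x) (kernel_eq_pos y).
  by rewrite -!surjective_pairing /kernel /induced /= => ->.
move=> x y /connectP[p]; elim: p x => [|z p IH] x /=; first by move=> _ ->.
case/andP => hxz hp yl; rewrite -(IH z hp yl).
have := kernel_eq_pos x; move: hxz; rewrite /kernel /induced /=.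
rewrite (surjective_pairing (val x)) (surjective_pairing (val z)) /= => hxz fx.
by rewrite (fconst _ _ _ _ (in_setT _) (in_setT _) hxz fx).
Qed.


Let kcolors_fsum v : kcolors f v <= fsum f v.
Proof.
rewrite /kcolors -sum1_card big_mkcond; apply: leq_sum => q _.
by rewrite inE; case: (f (v, q)).
Qed.

(** The kernel is a double cover of a cycle, determined by its monodromy [wrap]: the identity gives
    two cycles, the swap a Möbius ladder. Uncolourability ties the monodromy to the parity of
    [n]. *)
Lemma cycle_block_of_regular : (forall v, degin e setT v = 2) -> (forall v, 1 < kcolors f v) ->
  odd_cycle_block e H f \/ even_cycle_block e H f.
Proof.
move=> reg k_gt1; have [x0 _] : exists x0 : T, x0 \in T by apply/card_gt0P; exact: ltnW T_gt1.
have [n [theta [n3 thB eE]]] := cycle_enumeration esym eirr econn reg x0.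
have thI := bij_inj thB; have n_gt0 : 0 < n by apply: ltn_trans n3.
pose t k := theta (Ordinal (ltn_pmod k n_gt0)).
have tE (i : 'I_n) : t i = theta i.
  by congr theta; apply: val_inj; rewrite /= modn_small.
have tS (i : 'I_n) : theta (ordS i) = t i.+1 by congr theta; apply: val_inj.
have tn : t n = t 0 by congr theta; apply: val_inj; rewrite /= modnn mod0n.
have et k : e (t k) (t k.+1).
  rewrite eE cycle_graphE; apply/orP; left; rewrite -val_eqE /=.
  by rewrite -addn1 modnDml addn1.
have f1 x : f x != 0 -> f x = 1.
  case: x => v q; have := kcolors_multi q (k_gt1 v); rewrite tight reg.
  by case: (f _) => [|[|]].
have k2 v : kcolors f v = 2.
  by apply/eqP; rewrite eqn_leq k_gt1 andbT -(reg v) -tight kcolors_fsum.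
pose nb v q u := odflt q [pick r | H (v, q) (u, r)].
have nbP v q u : e v u -> 0 < f (v, q) -> H (v, q) (u, nb v q u) /\ 0 < f (u, nb v q u).
  move=> evu fq; have [r hr fr] := nbr evu fq.
  rewrite /nb; case: pickP => [r' hr'|/(_ r)]; last by rewrite hr.
  by rewrite /= (Hmatch hr' hr).
(* The layer reached from [(t 0, q)] after [k] steps along the kernel. Indices are taken modulo [n]
   in [t] but not in [L]: the layer [L q n] over [t 0] may differ from [q]. *)
pose L (q : 'I_s) k := iteri k (fun j r => nb (t j) r (t j.+1)) q.
have Lpos q k : 0 < f (t 0, q) -> 0 < f (t k, L q k).
  by move=> fq; elim: k => [//|k IH]; have [] := nbP _ _ _ (et k) IH.
have LH q k : 0 < f (t 0, q) -> H (t k, L q k) (t k.+1, L q k.+1).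
  by move=> fq; have [] := nbP _ _ _ (et k) (Lpos q k fq).
have LI q q' k : 0 < f (t 0, q) -> 0 < f (t 0, q') -> L q k = L q' k -> q = q'.
  move=> fq fq'; elim: k => [//|k IH] eqL; apply: IH.
  have := LH q k fq; have := LH q' k fq'; rewrite -eqL Hsym [H (t k, L q k) _]Hsym => h1 h2.
  exact: Hmatch h2 h1.
have [a [b [ab kE]]] : exists a b, a != b /\ [set q | 0 < f (t 0, q)] = [set a; b].
  by apply/cards2P; rewrite -(k2 (t 0)).
have I2 (j : 'I_2) : j = ord0 \/ j = ord_max.
  by case: j => [[|[|//]] jlt]; [left | right]; apply: val_inj.
pose c (j : 'I_2) := if j == ord0 then a else b.
have cI : injective c.
  by move=> j j'; case: (I2 j) => ->; case: (I2 j') => -> //; rewrite /c /= => h; rewrite h eqxx in ab.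
have cpos j : 0 < f (t 0, c j).
  have : c j \in [set q | 0 < f (t 0, q)] by rewrite kE /c !inE; case: ifP; rewrite eqxx ?orbT.
  by rewrite inE.
pose wrap (j : 'I_2) : 'I_2 := if L (c j) n == c ord0 then ord0 else ord_max.
have wrapE j : L (c j) n = c (wrap j).
  have : L (c j) n \in [set q | 0 < f (t 0, q)] by rewrite inE -tn; apply: Lpos.
  by rewrite kE !inE /wrap [c ord0]/c /=; case: eqP => [->|_ /eqP].
have wrapI : injective wrap.
  by move=> j j' hw; apply: cI; apply: (LI _ _ n) => //; rewrite !wrapE hw.
have arc_lift k j j' : H (t k, L (c j) k) (t k.+1, L (c j') k.+1) = (j == j').
  apply/idP/eqP => [h|<-]; last exact: LH.
  by apply: cI; apply: (LI _ _ k.+1) => //; apply: Hmatch (LH _ _ (cpos j)) h.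
pose glue (i : 'I_n) j := if i.+1 < n then j else wrap j.
have arcH (i : 'I_n) j j' :
    H (theta i, L (c j) i) (theta (ordS i), L (c j') (ordS i)) = (glue i j == j').
  rewrite -tE tS ordS_val /glue; case: ifP => lt; first exact: arc_lift.
  have iSn : i.+1 = n by have := ltn_ord i; move: lt; clear; lia.
  have wj : L (c j) i.+1 = c (wrap j) by rewrite iSn wrapE.
  apply/idP/eqP => [h|<-]; last by rewrite -[L _ 0]wj; apply: LH.
  by apply: cI; rewrite -wj; apply: Hmatch (LH _ _ (cpos j)) h.
have psi_pos (x : 'I_n * 'I_2) : f (theta x.1, L (c x.2) x.1) != 0.
  by rewrite -lt0n -tE; apply: Lpos.
pose psi x : {x : T * 'I_s | f x != 0} := exist (fun x => f x != 0) _ (psi_pos x).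
have Hpsi x y : kernel H f (psi x) (psi y) =
    (ordS x.1 == y.1) && (glue x.1 x.2 == y.2) || (ordS y.1 == x.1) && (glue y.1 y.2 == x.2).
  case: x y => [i j] [i' j']; rewrite /kernel /induced /=.
  apply/idP/orP => [h|].
    have := HE h; rewrite eE cycle_graphE; case/orP => /eqP ii; [left|right]; rewrite ii eqxx /=.
      by rewrite -ii arcH in h.
    by rewrite -ii Hsym arcH in h.
  by case=> /andP[/eqP<-]; rewrite -arcH // Hsym.
have psiB : bijective psi.
  apply: inj_card_bij; last first.
    rewrite card_kernel (eq_bigr (fun=> 2)) // sum_nat_const card_prod !card_ord.
    by rewrite -(bij_eq_card thB) card_ord.
  move=> [i j] [i' j'] /(congr1 val) [/thI ii].
  by rewrite -ii => /(LI _ _ _ (cpos j) (cpos j'))/cI ->.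
have iso_e : isomorphic e (@cycle_graph n) by apply: isomorphic_sym; exists theta.
(* Alternating between the two lifted layers gives a transversal inside the kernel, which would be
   good if it were independent. Its edge must be the one closing the cycle, since along every other
   arc the lifted layer stays while [par] changes. *)
pose par k : 'I_2 := if odd k then ord_max else ord0.
have not_indep : exists i i' : 'I_n, kernel H f (psi (i, par i)) (psi (i', par i')).
  suff /existsP[i /existsP[i' h]] : [exists i : 'I_n, [exists i' : 'I_n,
      kernel H f (psi (i, par i)) (psi (i', par i'))]] by exists i, i'.
  apply: contraNT fcrit => /existsPn indep.
  have [thi thK thiK] := thB.
  pose phi v := L (c (par (thi v))) (thi v).
  apply: (@colorableI _ _ _ _ _ phi); apply/goodP => A _ /set0Pn[v vA]; exists v => //.
  rewrite (_ : hdeg _ _ _ _ = 0); first by have := psi_pos (thi v, par (thi v)); rewrite /= thiK lt0n.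
  apply: eq_card0 => u; rewrite !inE; apply/negP => /andP[_ huv].
  have /existsPn/(_ (thi u)) := indep (thi v); rewrite /kernel /induced /= !thiK.
  by rewrite huv.
have parS i : glue i (par i) = par (ordS i) -> i.+1 = n /\ wrap (par i) = ord0.
  rewrite ordS_val /glue; case: ifP => lt; first by rewrite /par /=; case: odd.
  by split=> //; have := ltn_ord i; move: lt; clear; lia.
have [i [iSn wi]] : exists i : 'I_n, i.+1 = n /\ wrap (par i) = ord0.
  have [i [i']] := not_indep; rewrite Hpsi /= => /orP[]/andP[/eqP ii /eqP gi].
    by exists i; apply: parS; rewrite gi -ii.
  by exists i'; apply: parS; rewrite gi -ii.
have odd_n : odd n = ~~ odd i by have /= <- := congr1 odd iSn.
have wrap_max : wrap ord_max != wrap ord0 by rewrite (inj_eq wrapI).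
(* The last index has parity opposite to [n], so the closing edge ends in layer [ord0] and starts in
   layer [ord0] for odd [n], in [ord_max] for even [n]. One value of [wrap] fixes the
   permutation. *)
case: (boolP (odd n)) => on; [left | right]; exists n; split=> //.
- have wrapid j : wrap j = j.
    move: wi wrap_max; rewrite /par; have -> : odd i = false by move: on; rewrite odd_n => /negbTE.
    move=> /= w0; rewrite w0; case: (I2 j) => -> //.
    by case: (I2 (wrap ord_max)) => ->; rewrite ?eqxx.
  apply: isomorphic_sym; exists psi => // x y; rewrite Hpsi /glue !wrapid !if_same.
  rewrite /circular_ladder /cartesian /= andbF /= cycle_graphE [y.2 == _]eq_sym.
  by rewrite andbC [_ && (x.2 == y.2)]andbC -andb_orr.
have [w0 w1] : wrap ord0 = ord_max /\ wrap ord_max = ord0.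
  move: wi wrap_max; rewrite /par; have -> : odd i by move: on; rewrite odd_n negbK.
  by move=> /= ->; case: (I2 (wrap ord0)) => ->; rewrite ?eqxx.
have wrapN j j' : (wrap j == j') = (j != j').
  by case: (I2 j) => ->; case: (I2 j') => ->; rewrite ?w0 ?w1.
apply: isomorphic_sym; exists psi => // x y; rewrite Hpsi /mobius_ladder /=.
have arcE (u v : 'I_n * 'I_2) : (ordS u.1 == v.1) && (glue u.1 u.2 == v.2) = mobius_arc u v.
  rewrite /mobius_arc /= -val_eqE [val (ordS _)]ordS_val /glue.
  have := ltn_ord u.1; have := ltn_ord v.1; case: ifP => lt ltv ltu.
    by rewrite [_.+1 == n](_ : _ = false) ?orbF //; move: lt; clear; lia.
  rewrite wrapN; have -> : (u.1.+1 == n) by move: lt ltu; clear; lia.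
  rewrite [_.+1 == _ :> nat](_ : _ = false) /= ?[0 == _]eq_sym //.
  by move: lt ltv; clear; lia.
by rewrite !arcE.
Qed.

Lemma building_cover_of_nocut : building_cover e H f.
Proof.
have [_ cSv] := nocutP _ _ encut.
split=> //.
- have [T2|T3] := leqP #|T| 2.
    have coT u v : e u v = (u != v).
      apply/idP/idP => [|uv]; first by apply: contraTneq => ->; rewrite eirr.
      have uT : [set u; v] = setT.
        by apply/eqP; rewrite eqEcard subsetT cardsT cards2 uv.
      have := conn_connectT econn u v => /connectP[[|w p]] /=; first by move=> _ vu; rewrite vu eqxx in uv.
      case/andP => euw _ _; have : w \in [set u; v] by rewrite uT inE.
      by rewrite !inE => /orP[/eqP wu|/eqP<-//]; rewrite wu eirr in euw.
    right; have T2' : #|T| = 2 by apply/eqP; rewrite eqn_leq T2.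
    exists (fun x => cast_ord T2' (enum_rank x)).
      apply: inj_card_bij; last by rewrite card_ord T2'.
      by move=> x y /cast_ord_inj/enum_rank_inj.
    by move=> x y; rewrite coT -(inj_eq (inj_comp (@cast_ord_inj _ _ T2') enum_rank_inj)).
  left; split=> //; first by split; [exact: ltnW (ltnW _) | exact: conn_connectT].
  move=> v; split.
    rewrite card_sig; have := cardsC1 v; rewrite (eq_card (B := [pred x | x != v])).
      by move=> ->; move: T3; case: #|T| => [|[]].
    by move=> x; rewrite !inE.
  apply: conn_connect; have -> : [set x | x != v] = setT :\ v by apply/setP => x; rewrite !inE andbT.
  by apply: cSv; rewrite inE.
- by move=> v; rewrite -degin_setT -tight.
case: (boolP (complete_on e setT)) => [/complete_block_of_complete|ncT]; first by constructor 2.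
have [x0 _] : exists x0 : T, x0 \in T by apply/card_gt0P; exact: ltnW T_gt1.
have [k_gt1|k_le1] := ltnP 1 (kcolors f x0).
  have [coT|reg] := multi_structure esym eirr Hsym (@HE) (@Hmatch) s_gt0 encut fdeg fcrit (in_setT x0) k_gt1.
    by rewrite coT in ncT.
  case: cycle_block_of_regular; first by move=> v; apply: reg.
  - by move=> v; rewrite (kcolorsE v x0).
  - by constructor 3.
  by constructor 4.
constructor 1; apply: monoblock_of_single => v; rewrite (kcolorsE v x0).
apply/eqP; rewrite eqn_leq k_le1 /= lt0n; apply: contraTneq T_gt1 => k0.
(* Without kernel layers [x0] would have degree 0, and a connected graph with an isolated vertex has
   only that vertex. *)
have f0 q : f (x0, q) = 0.
  apply/eqP; rewrite -leqn0 leqNgt; apply/negP => fq.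
  by have := cards0_eq k0 => /setP/(_ q); rewrite !inE fq.
have : degin e setT x0 = 0 by rewrite -tight /fsum big1.
move/cards0_eq/setP => noedge; rewrite -leqNgt -(cards1 x0) -cardsT.
suff -> : setT = [set x0] by [].
symmetry; apply: (connP _ _ econn) => //; first by apply/set0Pn; exists x0; rewrite inE.
by apply/closed_inP => x y /set1P-> _ exy; have := noedge y; rewrite !inE exy.
Qed.

End BuildingCover.

(** * Gluing at a cut vertex *)

Lemma glue_subsets (s : nat) (T : finType) (e : rel T) (H : rel (T * 'I_s))
    (f f1 f2 : T * 'I_s -> nat) (S1 S2 : {set T}) (c : T)
    (cS1 : c \in S1) (cS2 : c \in S2) :
  (forall u v q r, H (u, q) (v, r) -> e u v) ->
  S1 :|: S2 = setT -> S1 :&: S2 = [set c] ->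
  (forall u v, e u v -> (u \in S1) && (v \in S1) || (u \in S2) && (v \in S2)) ->
  (forall q, f (c, q) = f1 (c, q) + f2 (c, q)) ->
  (forall u q, u \in S1 -> u != c -> f (u, q) = f1 (u, q)) ->
  (forall u q, u \in S2 -> u != c -> f (u, q) = f2 (u, q)) ->
  constructible (induced (P := fun x => x \in S1) e)
    (fun x y => H (val x.1, x.2) (val y.1, y.2)) (fun x => f1 (val x.1, x.2)) ->
  constructible (induced (P := fun x => x \in S2) e)
    (fun x y => H (val x.1, x.2) (val y.1, y.2)) (fun x => f2 (val x.1, x.2)) ->
  constructible e H f.
Proof.
move=> HE cover meet esplit fc h1 h2 con1 con2.
pose w1 := exist (fun x => x \in S1) c cS1; pose w2 := exist (fun x => x \in S2) c cS2.
apply: (@constructible_gluing s _ _ T _ _ _ _ _ _ e H f val val w1 w2 con1 con2) => //.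
- split; [exact: val_inj | exact: val_inj | |].
    move=> x; have : x \in S1 :|: S2 by rewrite cover inE.
    rewrite inE => /orP[xS|xS]; first by left; exists (exist (fun x => x \in S1) x xS).
    by right; exists (exist (fun x => x \in S2) x xS).
  move=> a b; split=> [ab|[-> ->]//].
  have ac : val a = c.
    by apply/set1P; rewrite -meet inE (valP a) ab (valP b).
  by split; apply: val_inj => //=; rewrite -ab.
- move=> x y; split=> [exy|[[a [a' [<- <-]]]|[b [b' [<- <-]]]]//].
  case/orP: (esplit x y exy) => /andP[xS yS]; [left | right].
    by exists (exist (fun x => x \in S1) x xS), (exist (fun x => x \in S1) y yS).
  by exists (exist (fun x => x \in S2) x xS), (exist (fun x => x \in S2) y yS).
- move=> [x q] [y r]; split=> [hxy|[[a [a' [<- <-]]]|[b [b' [<- <-]]]]//].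
  case/orP: (esplit x y (HE _ _ _ _ hxy)) => /andP[xS yS]; [left | right].
    by exists (exist (fun x => x \in S1) x xS, q), (exist (fun x => x \in S1) y yS, r).
  by exists (exist (fun x => x \in S2) x xS, q), (exist (fun x => x \in S2) y yS, r).
- by move=> [a aS] q; rewrite -val_eqE /= => ac; apply: h1.
- by move=> [a aS] q; rewrite -val_eqE /= => ac; apply: h2.
Qed.

Lemma critical_constructible (s : nat) (T : finType) (e : rel T) (H : rel (T * 'I_s))
    (f : T * 'I_s -> nat) :
  0 < s -> 1 < #|T| -> simple_graph e -> is_cover e H -> conn e setT ->
  feasible e setT f -> ~~ colorable H setT f -> constructible e H f.
Proof.
move=> s0; move: {2}#|T| (leqnn #|T|) => n.
elim: n T e H f => [|n IH] T e H f; first by case: #|T|.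
move=> Tn T1 se Hc cT fe nc.
have [esym eirr] := se; have [[Hsym Hirr] HE Hmatch] := Hc.
have onsub (S : {set T}) g : 1 < #|S| -> #|S| <= n -> conn e S -> feasible e S g ->
    ~~ colorable H S g ->
    constructible (induced (P := fun x => x \in S) e)
      (fun x y => H (val x.1, x.2) (val y.1, y.2)) (fun x => g (val x.1, x.2)).
  move=> S1 Sn cS feS ncS; have cardS : #|{: {x : T | x \in S}}| = #|S|.
    by rewrite card_sig; apply: eq_card.
  apply: IH; rewrite ?cardS //.
  - by split=> [x y|x] /=; [apply: esym | apply: eirr].
  - split; first by split=> [x y|x] /=; [apply: Hsym | apply: Hirr].
      by move=> u v q r /HE.
    by move=> u v q r r'; apply: Hmatch.
  - apply: connect_conn; apply: conn_connect.
    by have -> : [set x | x \in S] = S by apply/setP => x; rewrite inE.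
  - by move=> v _; rewrite degin_setT deg_induced; apply: feS (valP v).
  - by apply: contra ncS; apply: colorable_induced.
case: (boolP (nocut e setT)) => [ncut|].
  by apply: constructible_building; apply: building_cover_of_nocut.
rewrite /nocut cT negb_forall => /existsP[c]; rewrite negb_imply => /andP[cinT].
case/connPn => E [sE E0 clE neE].
have [g1 [g2 [[fe1 nc1] [fe2 nc2] fE]]] := split_cut esym eirr Hsym HE Hmatch s0 cT fe nc cinT sE clE.
have cE : c \notin E by apply/negP => /(subsetP sE); rewrite !inE eqxx.
have [z zE] := set0Pn _ E0.
have [z' z'E z'c] : exists2 z', z' \notin E & z' != c.
  have /subsetPn[z' z'T z'E] : ~~ (setT :\ c \subset E).
    by apply: contra neE => h; rewrite eqEsubset sE.
  by exists z' => //; move: z'T; rewrite !inE andbT.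
have S2E : setT :\: E = c |: (setT :\ c :\: E).
  by apply/setP => x; rewrite !inE; case: (eqVneq x c) => [->|] //=; rewrite cE.
have cS1 : c \in c |: E by rewrite !inE eqxx.
have cS2 : c \in setT :\: E by rewrite !inE cE.
have card2 (S : {set T}) a b : a \in S -> b \in S -> a != b -> 1 < #|S|.
  by move=> aS bS ab; apply/card_gt1P; exists a, b.
have cardn (S : {set T}) a : a \notin S -> #|S| <= n.
  move=> aS; rewrite -ltnS; apply: leq_trans Tn; rewrite -cardsT; apply: proper_card.
  by rewrite properT; apply: contraNneq aS => ->; rewrite inE.
apply: (glue_subsets cS1 cS2 HE (f1 := set_fibre f c g1) (f2 := set_fibre f c g2)).
- by apply/setP => x; rewrite !inE; case: (x \in E); rewrite ?orbT.
- apply/setP => x; rewrite !inE; case: (eqVneq x c) => [->|] //=; first by rewrite cE.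
  by case: (x \in E).
- move=> u v euv; rewrite !inE.
  have cl x y : x \in E -> e x y -> (y == c) || (y \in E).
    move=> xE exy; case: eqVneq => //= yc; apply: (closed_inP _ _ _ clE x) => //.
    by rewrite !inE yc.
  case: (boolP (u \in E)) => uE; first by rewrite orbT (cl u v).
  case: (boolP (v \in E)) => vE; rewrite ?orbT //=.
  by rewrite orbF; rewrite esym in euv; move: (cl v u vE euv); rewrite (negbTE uE) orbF => ->.
- by move=> q; rewrite !set_fibre_eq.
- by move=> u q _ uc; rewrite set_fibre_neq.
- by move=> u q _ uc; rewrite set_fibre_neq.
- apply: onsub => //.
  + by apply: (card2 _ c z) => //; [rewrite !inE zE orbT | apply: contraNneq cE => ->].
  + by apply: (cardn _ z'); rewrite !inE negb_or z'c.
  + exact: conn_branch clE.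
- apply: onsub => //.
  + by apply: (card2 _ c z') => //; [rewrite !inE z'E | rewrite eq_sym].
  + by apply: (cardn _ z); rewrite !inE zE.
  + rewrite S2E; apply: (conn_branch esym cT cinT (subsetDl _ _)); exact: closed_inC.
Qed.

(** * Constructible covers have no good transversal *)

Lemma deg_isomorphic (T U : finType) (e : rel T) (e' : rel U) (phi : T -> U) :
  bijective phi -> (forall x y, e' (phi x) (phi y) = e x y) ->
  forall x, deg e' (phi x) = deg e x.
Proof.
move=> bphi he x; rewrite /deg -(card_imset _ (bij_inj bphi)); apply: eq_card => y.
have [psi phiK psiK] := bphi; rewrite !inE; apply/idP/imsetP => [h|[z]].
  by exists (psi y); rewrite ?psiK // inE -he psiK.
by rewrite inE -he => h ->.
Qed.

Lemma sum_deg_isomorphic (T U : finType) (e : rel T) (e' : rel U) :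
  isomorphic e e' -> \sum_x deg e x = \sum_y deg e' y.
Proof.
case=> phi bphi he; rewrite [RHS](reindex phi) /=; last exact: onW_bij.
by apply: eq_bigr => x _; rewrite (deg_isomorphic bphi he).
Qed.

Lemma sum_kernel (s : nat) (T : finType) (f g : T * 'I_s -> nat) :
  (forall x, f x = 0 -> g x = 0) ->
  \sum_(x : {x : T * 'I_s | f x != 0}) g (val x) = \sum_v \sum_(q < s) g (v, q).
Proof.
move=> g0; rewrite pair_bigA /= (bigID (fun x => f x != 0)) /= [X in _ + X]big1 ?addn0.
  rewrite [RHS](reindex_omap (fun x : {x : T * 'I_s | f x != 0} => val x) insub) /=; last first.
    by move=> x fx; rewrite insubT.
  by apply: eq_big => [x|x _]; rewrite ?valK ?eqxx ?(valP x) -?surjective_pairing.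
by move=> [v q] /negPn/eqP/g0.
Qed.

(* An independent set with half of the vertices of a union of cycles contains
   exactly one vertex of each edge. *)
Lemma half_independent (K : finType) (sigma : K -> K) (chi : pred K) :
  injective sigma -> #|chi|.*2 = #|K| -> (forall x, ~~ (chi x && chi (sigma x))) ->
  forall x, chi (sigma x) = ~~ chi x.
Proof.
move=> sI cK ind.
have le x : (chi x + chi (sigma x) : nat) <= 1.
  by have := ind x; case: (chi x); case: (chi (sigma x)).
(* The sum counts every selected vertex twice, so it equals [#|K|]; as no term exceeds 1, each term
   is 1. *)
have sumE : \sum_x (chi x + chi (sigma x) : nat) = \sum_(x : K) 1.
  rewrite big_split /= -(reindex sigma (P := predT) (F := fun x => chi x : nat)) /=; last first.
    exact: onW_bij (injF_bij sI).
  have cE : \sum_x (chi x : nat) = #|chi|.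
    rewrite -sum1_card [RHS]big_mkcond; apply: eq_bigr => x _.
    by rewrite unfold_in; case: (chi x).
  by rewrite sum1_card -cK -addnn cE.
move=> x; have [_] := leqif_sum (P := predT) (fun i _ => leqif_eq (le i)).
rewrite sumE eqxx => /esym/forallP/(_ x) /=.
by case: (chi x); case: (chi (sigma x)).
Qed.

(* One step around the ladder: [tau] is the identity for the circular ladder and
   the swap for the Moebius ladder. *)
Definition ladder_step n (tau : 'I_2 -> 'I_2) (x : 'I_n * 'I_2) : 'I_n * 'I_2 :=
  (ordS x.1, if x.1.+1 < n then x.2 else tau x.2).

Lemma ladder_step_inj n tau : injective tau -> injective (@ladder_step n tau).
Proof.
move=> tauI [i j] [i' j'] h.
have /(can_inj (@ordSK n)) ii : ordS i = ordS i' := congr1 (@fst _ _) h.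
have := congr1 (@snd _ _) h; rewrite /= ii.
by case: ifP => _ => [->|/tauI->].
Qed.

Lemma ladder_rail n (i0 : 'I_n) (P : 'I_n * 'I_2 -> bool) :
  i0 = 0 :> nat -> (forall (i i' : 'I_n) j, i.+1 = i' :> nat -> P (i', j) = P (i, j)) ->
  forall i j, P (i, j) = P (i0, j).
Proof.
move=> i00 step [k kn] j; elim: k kn => [|k IH] kn.
  by congr (P (_, _)); apply: val_inj.
by rewrite -(IH (ltnW kn)); apply: step.
Qed.

Section Converse.
Variables (s : nat) (T : finType) (e : rel T) (H : rel (T * 'I_s)).
Variable f : T * 'I_s -> nat.
Hypothesis building : building_cover e H f.
Variable phi : T -> 'I_s.
Hypothesis gphi : good H setT f phi.

Let esimple : simple_graph e. Proof. by case: building. Qed.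
Let Hsimple : simple_graph H. Proof. by case: building => _ _ []. Qed.
Let HE u v q r : H (u, q) (v, r) -> e u v.
Proof. by case: building => _ _ [_ h _] _ _; apply: h. Qed.
Let Hmatch u v q r r' : H (u, q) (v, r) -> H (u, q) (v, r') -> r = r'.
Proof. by case: building => _ _ [_ _ h] _ _; apply: h. Qed.
Let fsumE v : \sum_(q < s) f (v, q) = deg e v.
Proof. by case: building. Qed.
Let Tgt0 : 0 < #|T|.
Proof.
case: building => _ [[]|[h /bij_eq_card]] //; first by case: #|T|.
by rewrite card_ord => ->.
Qed.

Let fphi v : f (v, phi v) != 0.
Proof.
have [|_ /set1P->] := goodP _ _ _ _ gphi [set v] (subsetT _); last by case: (f _).
by apply/set0Pn; exists v; rewrite inE.
Qed.

Let chosen v : {x : T * 'I_s | f x != 0} := exist (fun x => f x != 0) _ (fphi v).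

Let chosenI : injective chosen. Proof. by move=> u v /(congr1 val)[]. Qed.

Lemma hdeg_deg v : hdeg H phi setT v <= deg e v.
Proof.
apply: subset_leq_card; apply/subsetP => u; rewrite !inE /=; exact: HE.
Qed.

(** Only degree sums are compared, as the isomorphism may ignore fibres. The transversal is the
    whole kernel and no degree in it exceeds the base degree, yet goodness on all of [T] yields a
    vertex strictly below. *)
Lemma not_monoblock : ~ monoblock e H f.
Proof.
move=> iso; have := sum_deg_isomorphic iso.
have cB : bijective chosen.
  by apply: inj_card_bij => //; case: iso => h /bij_eq_card->.
have [t0 _] : exists t : T, t \in T by apply/card_gt0P.
rewrite (reindex chosen) /=; last exact: onW_bij.
have degE v : deg (kernel H f) (chosen v) = hdeg H phi setT v.
  rewrite /hdeg -(card_imset _ chosenI); apply: eq_card => x.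
  have [chi chK Kch] := cB; apply/idP/imsetP => [|[u]]; rewrite !inE.
    by rewrite -[x]Kch => h; exists (chi x); rewrite ?Kch // !inE.
  by move=> h ->.
under eq_bigr => v _ do rewrite degE.
have [v _ lt] := goodP _ _ _ _ gphi setT (subsetT _) (introT (set0Pn _) (ex_intro _ t0 (in_setT t0))).
rewrite (bigD1 v) //= [X in _ = X -> _](bigD1 v) //=.
have : \sum_(u | u != v) hdeg H phi setT u <= \sum_(u | u != v) deg e u.
  by apply: leq_sum => u _; exact: hdeg_deg.
have : f (v, phi v) <= deg e v by rewrite -fsumE (bigD1 (phi v)) //= leq_addr.
move: lt; clear; lia.
Qed.

(** The values of the copies add up to [p.-1] while [p] vertices are chosen, so some copy holds more
    chosen vertices than its value. They form a clique from which no vertex can be removed. *)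
Lemma not_complete_block : ~ complete_block e H f.
Proof.
case=> p [r [p2 isoe isoH fconst]]; have [psi psiB psiE] := isomorphic_sym isoH.
have Tp : #|T| = p by case: isoe => h /bij_eq_card->; rewrite card_ord.
have p_gt0 : 0 < p by apply: ltnW.
pose i0 := Ordinal p_gt0.
pose a (j : 'I_r) := f (val (psi (i0, j))).
have fa i j : f (val (psi (i, j))) = a j.
  apply: fconst; case: (eqVneq i i0) => [->|ii]; first exact: connect0.
  by apply: connect1; rewrite psiE /complete_copies /cartesian /= eqxx /complete_graph /= ii orbT.
have sum_a : \sum_j a j = p.-1.
  apply/eqP; rewrite -(eqn_pmul2l p_gt0); apply/eqP.
  have deg_p v : deg e v = p.-1.
    case: isoe => h hB hE; rewrite -(deg_isomorphic hB hE) /deg.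
    have := cardsC1 (h v); rewrite card_ord => <-; apply: eq_card => x.
    by rewrite !inE /complete_graph /= eq_sym.
  transitivity (\sum_v \sum_(q < s) f (v, q)); last first.
    by under eq_bigr => v _ do rewrite fsumE deg_p; rewrite sum_nat_const Tp.
  rewrite -(sum_kernel (f := f)) // (reindex psi) /=; last exact: onW_bij.
  transitivity (\sum_(i < p) \sum_(j < r) a j).
    by rewrite sum_nat_const card_ord.
  by rewrite pair_bigA /=; apply: eq_bigr => -[i j] _; rewrite fa.
have [chi psiK chiK] := psiB.
pose cls v := (chi (chosen v)).2.
have [j lt] : exists j, a j < #|[set v | cls v == j]|.
  apply/existsP; apply: contraT => /existsPn h.
  suff : p <= p.-1 by case: (p) (p_gt0) => [|p1] //=; rewrite ltnn.
  rewrite -sum_a -[X in X <= _]Tp -sum1_card (partition_big cls predT) //=.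
  apply: leq_sum => j _; have := h j; rewrite -leqNgt; apply: leq_trans.
  by rewrite sum1_card; apply: subset_leq_card; apply/subsetP => v; rewrite !inE.
have [|v] := goodP _ _ _ _ gphi [set v | cls v == j] (subsetT _).
  by rewrite -card_gt0; apply: leq_ltn_trans lt.
rewrite inE => /eqP vj; apply/negP; rewrite -leqNgt.
have chE u : psi (chi (chosen u)) = chosen u by rewrite chiK.
have -> : f (v, phi v) = a j.
  have := fa (chi (chosen v)).1 (chi (chosen v)).2; rewrite -surjective_pairing chE => ->.
  by rewrite -vj.
have vin : v \in [set v | cls v == j] by rewrite inE vj.
move: lt; rewrite (cardsD1 v) vin add1n ltnS => /leq_trans; apply.
apply: subset_leq_card; apply/subsetP => u; rewrite !inE => /andP[uv uj]; rewrite uj /=.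
have cls_eq : (chi (chosen v)).2 = (chi (chosen u)).2 by rewrite -/(cls v) vj -(eqP uj).
suff : kernel H f (chosen v) (chosen u) by [].
rewrite -[chosen v]chE -[chosen u]chE psiE; apply/orP; right.
rewrite cls_eq eqxx; apply: contra uv => /eqP eq1; apply/eqP/chosenI.
by rewrite -[LHS]chE -[RHS]chE [X in psi X]surjective_pairing -eq1 -cls_eq -surjective_pairing.
Qed.

Section Ladders.
Hypothesis f1 : forall x, f x != 0 -> f x = 1.
Variables (n : nat) (psi : 'I_n * 'I_2 -> {x : T * 'I_s | f x != 0}).
Hypothesis n_gt2 : 2 < n.
Hypothesis Tn : #|T| = n.
Hypothesis psiB : bijective psi.
Variable tau : 'I_2 -> 'I_2.
Hypothesis tauI : injective tau.
Hypothesis adj : forall x, kernel H f (psi x) (psi (ladder_step tau x)).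

Definition selected x : bool := (val (psi x)).2 == phi (val (psi x)).1.

(** With all kernel values 1, a good transversal is independent, and it contains [n] of the [2n]
    kernel vertices. *)
Lemma selected_alternates x : selected (ladder_step tau x) = ~~ selected x.
Proof.
have [chi psiK chiK] := psiB; apply: (@half_independent _ (ladder_step tau) selected); first exact: ladder_step_inj.
  have chI : injective (fun v => chi (chosen v)).
    by move=> u v /(can_inj chiK)/chosenI.
  have -> : #|selected| = #|T|.
    rewrite -cardsT -(card_imset _ chI); apply: eq_card => y; apply/idP/imsetP => [ys|[v _ ->]].
      exists (val (psi y)).1 => //; apply: (can_inj psiK); rewrite chiK; apply: val_inj => /=.
      by rewrite [LHS]surjective_pairing; congr pair; apply/eqP.
    by rewrite unfold_in /selected chiK /=.
  by rewrite card_prod !card_ord Tn muln2.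
move=> {}x; apply/negP => /andP[/eqP sx /eqP sy].
have := adj x; rewrite /kernel /induced /=.
rewrite (surjective_pairing (val (psi x))) sx.
rewrite (surjective_pairing (val (psi (ladder_step tau x)))) sy.
set u := (val _).1; set v := (val _).1 => huv.
have [|w wA] := goodP _ _ _ _ gphi [set u; v] (subsetT _).
  by apply/set0Pn; exists u; rewrite !inE eqxx.
rewrite f1 ?fphi // ltnS leqn0 cards_eq0 => /eqP/setP nadj.
have [Hsym _] := Hsimple; move: wA; rewrite !inE => /orP[] /eqP wE.
  by have := nadj v; rewrite wE !inE huv eqxx orbT.
by have := nadj u; rewrite wE !inE Hsym huv eqxx.
Qed.

Let i0 : 'I_n := Ordinal (ltn_trans (isT : 0 < 2) n_gt2).
Let imax : 'I_n := rev_ord i0.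

Let step_rail (i i' : 'I_n) j : i.+1 = i' :> nat -> ladder_step tau (i, j) = (i', j).
Proof.
move=> ii; have lt : i.+1 < n by rewrite ii.
by rewrite /ladder_step /= lt; congr pair; apply: ord_inj; rewrite ordS_val lt.
Qed.

Let step_max j : ladder_step tau (imax, j) = (i0, tau j).
Proof.
have h : (imax.+1 < n) = false by rewrite /= subnSK ?subn0 ?ltnn //; exact: ltn_trans n_gt2.
by rewrite /ladder_step /= -/(nat_of_ord imax) h; congr pair; apply: ord_inj; rewrite ordS_val h.
Qed.

(** Selection flips at each of the [n] steps around a closed rail, which is impossible for odd
    [n]. *)
Lemma no_circular_ladder : odd n -> (forall j, tau j = j) -> False.
Proof.
move=> on tau_id; pose P x := selected x (+) odd x.1.
have := @ladder_rail n i0 P erefl _ imax ord0; rewrite /P /=.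
have -> : odd (n - 1) = false by rewrite oddB ?on //; exact: ltn_trans n_gt2.
rewrite !addbF => h; have := selected_alternates (imax, ord0).
rewrite step_max tau_id h; first by case: selected.
move=> i i' j ii; rewrite /P /= -(step_rail j ii) selected_alternates.
by rewrite -ii /= addbN addNb negbK.
Qed.

(** The isomorphism does not tell over which base vertex [psi (i, j)] lies, so parity is read from
    the two-colouring [side] of the even base cycle. Selection and [side] flip together along the
    closed walk through both rails, so every chosen vertex lies on the same side, yet every base
    vertex is chosen and both sides occur. *)
Lemma no_mobius_ladder : isomorphic e (@cycle_graph n) -> ~~ odd n ->
  (forall j, tau j != j) -> False.
Proof.
case=> h hB hE en tau_sw; pose side v := odd (h v).
have side_e u v : e u v -> side v = ~~ side u.
  have oddS (i : 'I_n) : odd (ordS i) = ~~ odd i.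
    rewrite ordS_val; case: ifP => // lt; have iSn : i.+1 = n.
      by have := ltn_ord i; move: lt; clear; lia.
    by have := congr1 odd iSn; rewrite (negbTE en) /= => ->.
  by rewrite -hE cycle_graphE /side => /orP[] /eqP<-; rewrite oddS ?negbK.
pose P x := selected x (+) side (val (psi x)).1.
have stepP x : P (ladder_step tau x) = P x.
  rewrite /P selected_alternates.
  have : e (val (psi x)).1 (val (psi (ladder_step tau x))).1.
    have := adj x; rewrite /kernel /induced /=.
    rewrite (surjective_pairing (val (psi x))).
    by rewrite (surjective_pairing (val (psi (ladder_step tau x)))) => /HE.
  by move/side_e->; rewrite addbN addNb negbK.
have rail i j : P (i, j) = P (i0, j).
  by apply: (@ladder_rail n i0 P erefl) => {}i i' {}j ii; rewrite -(step_rail j ii) stepP.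
have ends j : P (i0, tau j) = P (i0, j) by rewrite -step_max stepP rail.
have I2 (j : 'I_2) : j = ord0 \/ j = ord_max.
  by case: j => [[|[|//]] jlt]; [left | right]; apply: val_inj.
have tau0 : tau ord0 = ord_max.
  by have := tau_sw ord0; case: (I2 (tau ord0)) => ->; rewrite ?eqxx.
have Pconst x : P x = P (i0, ord0).
  case: x => i j; rewrite rail; case: (I2 j) => -> //.
  by rewrite -tau0 ends.
have side_const v : side v = ~~ P (i0, ord0).
  have [chi psiK chiK] := psiB.
  by rewrite -(Pconst (chi (chosen v))) /P /selected chiK /= eqxx /= negbK.
have [g hK gK] := hB; have := side_const (g i0); rewrite -(side_const (g (ordS i0))).
rewrite /side !gK ordS_val; case: ifP => //.
by move: n_gt2 => /= n2; clear -n2; lia.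
Qed.

End Ladders.

Lemma building_not_good : False.
Proof.
case: building => _ _ _ _ [/not_monoblock|/not_complete_block||] //.
- case=> n [n3 on isoe isoH f1]; have [psi psiB psiE] := isomorphic_sym isoH.
  have Tn : #|T| = n by case: isoe => h /bij_eq_card->; rewrite card_ord.
  apply: (no_circular_ladder f1 n3 Tn psiB (tau := id)) => // -[i j].
  rewrite psiE /circular_ladder /cartesian /ladder_step /= if_same eqxx.
  by rewrite cycle_graphE eqxx orbT.
case=> n [n3 on isoe isoH f1]; have [psi psiB psiE] := isomorphic_sym isoH.
have Tn : #|T| = n by case: isoe => h /bij_eq_card->; rewrite card_ord.
apply: (no_mobius_ladder f1 n3 Tn psiB (tau := @rev_ord 2)) => //.
- exact: rev_ord_inj.
- move=> [i j]; rewrite psiE /mobius_ladder /mobius_arc /ladder_step [rel_of_simpl _]/= /=.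
  apply/orP; left; rewrite -[(i.+1 %% n)]/(nat_of_ord (ordS i)) ordS_val.
  have := ltn_ord i; case: (ltnP i.+1 n) => lt ltn; first by rewrite !eqxx.
  have -> : i.+1 == n by move: lt ltn; clear; lia.
  by rewrite eqxx /=; case: j => [[|[|//]] jlt].
by case=> [[|[|//]] jlt].
Qed.

End Converse.

Lemma bad_subset (s : nat) (T : finType) (H : rel (T * 'I_s)) (S : {set T}) f phi :
  ~~ good H S f phi ->
  exists A : {set T}, [/\ A \subset S, A != set0 & forall v, v \in A -> f (v, phi v) <= hdeg H phi A v].
Proof.
rewrite negb_forall => /existsP[A]; rewrite negb_imply => /andP[/andP[sA A0]].
move/exists_inPn => h; exists A; split=> // v /h; by rewrite -leqNgt.
Qed.

(** Two bad sets containing the cut vertex have a bad union, since degrees there add just as budgets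
    do; a bad set missing the cut vertex is bad by itself. Irreflexivity is carried through the
    induction because it keeps the two neighbourhoods of the cut vertex disjoint. *)
Lemma constructible_not_good (s : nat) (T : finType) (e : rel T) (H : rel (T * 'I_s))
    (f : T * 'I_s -> nat) : constructible e H f ->
  irreflexive H /\ forall phi, ~~ good H setT f phi.
Proof.
elim=> {T e H f} [T e H f bu|].
  split=> [|phi]; first by case: bu => _ _ [[]].
  by apply/negP => /(building_not_good bu).
move=> T1 T2 T e1 H1 f1 e2 H2 f2 e H f i1 i2 w1 w2 _ [irr1 ng1] _ [irr2 ng2].
move=> [I1 I2 cov meet] _ HE fw fi1 fi2.
have lift1 a a' q q' : H1 (a, q) (a', q') -> H (i1 a, q) (i1 a', q').
  by move=> h; apply/HE; left; exists (a, q), (a', q').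
have lift2 a a' q q' : H2 (a, q) (a', q') -> H (i2 a, q) (i2 a', q').
  by move=> h; apply/HE; right; exists (a, q), (a', q').
split=> [x|phi].
  have liftI (U : finType) (i : U -> T) : injective i -> injective (@lift_layers s U T i).
    by move=> iI [a q] [b r] [/iI-> ->].
  by apply/negP => /HE[[a [a' [<- /(liftI _ _ I1)->]]]|[a [a' [<- /(liftI _ _ I2)->]]]];
    rewrite ?irr1 ?irr2.
apply/negP => /goodP gd.
have [A1 [_ A10 bad1]] := bad_subset (ng1 (phi \o i1)).
have [A2 [_ A20 bad2]] := bad_subset (ng2 (phi \o i2)).
have le1 (A : {set T}) a : i1 @: A1 \subset A -> hdeg H1 (phi \o i1) A1 a <= hdeg H phi A (i1 a).
  move=> /subsetP sA; rewrite /hdeg -(card_imset _ I1); apply: subset_leq_card; apply/subsetP => u.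
  case/imsetP => b; rewrite inE => /andP[bA h] ->; rewrite inE sA ?imset_f //=.
  exact: lift1.
have le2 (A : {set T}) a : i2 @: A2 \subset A -> hdeg H2 (phi \o i2) A2 a <= hdeg H phi A (i2 a).
  move=> /subsetP sA; rewrite /hdeg -(card_imset _ I2); apply: subset_leq_card; apply/subsetP => u.
  case/imsetP => b; rewrite inE => /andP[bA h] ->; rewrite inE sA ?imset_f //=.
  exact: lift2.
have im0 (U : finType) (i : U -> T) (A : {set U}) : A != set0 -> i @: A != set0.
  by case/set0Pn => x xA; apply/set0Pn; exists (i x); apply: imset_f.
have ok1 (A : {set T}) a : i1 @: A1 \subset A -> a \in A1 -> a != w1 ->
    f (i1 a, phi (i1 a)) <= hdeg H phi A (i1 a).
  by move=> sA aA aw; rewrite fi1 //; apply: leq_trans (bad1 a aA) (le1 A a sA).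
have ok2 (A : {set T}) a : i2 @: A2 \subset A -> a \in A2 -> a != w2 ->
    f (i2 a, phi (i2 a)) <= hdeg H phi A (i2 a).
  by move=> sA aA aw; rewrite fi2 //; apply: leq_trans (bad2 a aA) (le2 A a sA).
have i12 : i1 w1 = i2 w2 by apply/meet.
case: (boolP (w1 \in A1)) => wA1; last first.
  have [_ /imsetP[a aA ->]] := gd _ (subsetT _) (im0 _ i1 _ A10).
  by apply/negP; rewrite -leqNgt ok1 //; apply: contraNneq wA1 => <-.
case: (boolP (w2 \in A2)) => wA2; last first.
  have [_ /imsetP[a aA ->]] := gd _ (subsetT _) (im0 _ i2 _ A20).
  by apply/negP; rewrite -leqNgt ok2 //; apply: contraNneq wA2 => <-.
pose A := i1 @: A1 :|: i2 @: A2.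
have okw : f (i1 w1, phi (i1 w1)) <= hdeg H phi A (i1 w1).
  rewrite fw; apply: (@leq_trans (hdeg H1 (phi \o i1) A1 w1 + hdeg H2 (phi \o i2) A2 w2)).
    by apply: leq_add; [exact: bad1 | have := bad2 w2 wA2; rewrite /= -i12].
  rewrite /hdeg -(card_imset _ I1) -(card_imset _ I2).
  set N1 := i1 @: _; set N2 := i2 @: _.
  have -> : #|N1| + #|N2| = #|N1 :|: N2|.
    rewrite cardsU (_ : N1 :&: N2 = set0) ?cards0 ?subn0 //.
    apply/setP => x; rewrite !inE; apply/negP => /andP[/imsetP[a aN ->] /imsetP[b _ /meet[aw _]]].
    by move: aN; rewrite aw inE irr1 andbF.
  apply: subset_leq_card; apply/subsetP => x; rewrite in_setU => /orP[] /imsetP[b];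
    rewrite inE => /andP[bA h] ->; rewrite !inE ?imset_f ?orbT //=.
    exact: lift1.
  by rewrite i12; apply: lift2.
have [|x] := gd A (subsetT _).
  by have := im0 _ i1 _ A10; rewrite -!card_gt0 => h; apply: leq_trans h (subset_leq_card (subsetUl _ _)).
rewrite inE => /orP[] /imsetP[a aA ->]; apply/negP; rewrite -leqNgt.
  by case: (eqVneq a w1) => [->//|aw]; apply: ok1 => //; apply: subsetUl.
by case: (eqVneq a w2) => [->|aw]; [rewrite -i12 | apply: ok2 => //; apply: subsetUr].
Qed.

Theorem theorem2p9 (s : nat) (T : finType) (e : rel T)
    (H : rel (T * 'I_s)) (f : T * 'I_s -> nat)
    (hs : 0 < s)
    (hG : simple_graph e)
    (hconn : connected e)
    (hH : is_cover e H)
    (hf : forall v : T, deg e v <= \sum_(q < s) f (v, q))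
    (hK1 : #|T| = 1 -> exists x : T * 'I_s, f x != 0) :
  (exists R : {set T * 'I_s}, strictly_degenerate_transversal H f R) <->
  ~ constructible e H f.
Proof.
have [sH _ _] := hH; have [Tgt0 ce] := hconn.
split=> [/(transversal_colorable f sH hs) col con|ncon].
  have /existsP[phi gphi] := col; have [_ ng] := constructible_not_good con.
  by have := ng phi; rewrite gphi.
apply/(transversal_colorable f sH hs); apply: contraT => ncol.
have [T1|T1] := ltnP 1 #|T|.
  case: ncon; apply: critical_constructible => //; first exact: connect_conn.
  by move=> v _; rewrite degin_setT.
(* Constructible covers have at least two base vertices, so over one vertex a transversal must
   always exist; [hK1] supplies the positive value for it. *)
have {}T1 : #|T| = 1 by apply/eqP; rewrite eqn_leq T1.
have [[v q] fv] := hK1 T1; case/negP: ncol.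
apply: (@colorableI _ _ _ _ _ (fun=> q)); apply/goodP => A _ /set0Pn[u uA]; exists u => //.
have all_v w : w = v.
  have : #|[set w; v]| <= 1 by rewrite -T1 max_card.
  by rewrite cards2; case: eqVneq.
rewrite (all_v u) (_ : hdeg _ _ _ _ = 0) ?lt0n //.
by apply: eq_card0 => w; rewrite !inE (all_v w); case: sH => _ ->; rewrite andbF.
Qed.
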